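(* Let $d\ge2$, $T>0$, $-d<\gamma\le0$ and $s\in(0,1)$ with $\gamma+2s>-2$. Let $f$ be a non-negative H-solution to the Cauchy problem for the spatially homogeneous Boltzmann equation $\partial_tf(t,v)=Q(f,f)(t,v)$, $f(0,v)=f_0(v)$, where the non-negative initial datum $f_0$ satisfies, for some $m_0,M_0,E_0>0$ and $H_0\in\mathbb{R}$, $m_0\le\int f_0\,dv\le M_0$, $\int f_0|v|^2\,dv\le E_0$ and $\int f_0\log f_0\,dv\le H_0$. Then for every $R>0$ $$\int_0^T\int_{B_R}\int_{B_R}f(t,v)\,f(t,v_* )\,|v-v_*|^{\gamma+2}\,dv\,dv_*\,dt<\infty ,$$ where $B_R\subset\mathbb{R}^d$ is the ball of radius $R$ centered at the origin.
   Context: Collision kernel: $B(|v-v_*|,\cos\Theta)=\Phi(|v-v_*|)b(\cos\Theta)$, with $\Phi(|z|)=c_\Phi|z|^\gamma$, $c_\Phi>0$, and $b\ge0$ measurable satisfying, for some $c_b>0$, $c_b^{-1}\Theta^{-1-2s}\le(\sin\Theta)^{d-2}b(\cos\Theta)\le c_b\Theta^{-1-2s}$ for all $\Theta\in(0,\pi/2]$. For $v,v_*\in\mathbb{R}^d$, $\sigma\in\mathbb{S}^{d-1}$: $v'=\frac{v+v_*}{2}+\frac{|v_*-v|}{2}\sigma$, $v_*'=\frac{v+v_*}{2}-\frac{|v_*-v|}{2}\sigma$, $\cos\Theta=\sigma\cdot\frac{v-v_*}{|v-v_*|}$. The collision operator is $Q(g,f)(v)=\int_{\mathbb{R}^d}\int_{\mathbb{S}^{d-1}}\left(g(v_*')f(v')-g(v_*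 )f(v)\right)B\,d\sigma\,dv_*$. Entropy dissipation: $$D(f)=\frac14\int_{\mathbb{R}^d}\int_{\mathbb{R}^d}\int_{\mathbb{S}^{d-1}}\left(f(v)f(v_* )-f(v')f(v_*')\right)\ln\frac{f(v)f(v_* )}{f(v')f(v_*')}\,B\,d\sigma\,dv_*\,dv\in[0,\infty],$$ which is the symmetrized form of $-\langle Q(f,f),\ln f\rangle_{L^2(\mathbb{R}^d)}$; $(x-y)\ln(x/y)$ is read as $0$ if $x=y=0$ and $+\infty$ if exactly one of $x,y$ is $0$. H-solution (in the sense of Villani): a non-negative $f\in L^\infty([0,\infty);L^1_2(\mathbb{R}^d))\cap C([0,\infty);\mathcal{D}'(\mathbb{R}^d))$, where $\|g\|_{L^1_2}=\int(1+|v|^2)|g|\,dv$, with $f(0,\cdot)=f_0$ such that (i) mass, momentum and energy are conserved: $\int f(t,v)\varphi(v)\,dv=\int f_0\varphi\,dv$ for all $t\ge0$ and $\varphi\in\{1,v_1,\dots,v_d,|v|^2\}$; (ii) the entropy inequality holds: $\int f(t)\log f(t)\,dv+\int_0^tD(f(\tau))\,d\tau\le\int f_0\log f_0\,dv$ for all $t\ge0$; (iii) for every compactly supported test function $\varphi\in C^1([0,\infty);C_c^\infty(\mathbb{R}^d))$, $-\int f_0\varphi(0,\cdot)\,dv-\int_0^\infty\!\int f\,\partial_t\varphi\,dv\,dt=\int_0^\infty\langle Q(f,f),\varphi\rangle\,dt$, where $\langle Q(f,f),\varphi\rangle=\frac14\int\int\int B\,(f'f'_*-ff_* )(\varphi+\varphi_*-\varphi'-\varphi'_*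 )\,d\sigma\,dv_*\,dv$ (with $f'=f(v')$, $f_*=f(v_* )$, etc.). *)

(* Defs.v *)
From HB Require Import structures.
From mathcomp Require Import all_boot all_order all_algebra.
From mathcomp Require Import all_classical all_reals all_analysis.
From mathcomp Require Import measurable_realfun.

Set Implicit Arguments.
Unset Strict Implicit.
Unset Printing Implicit Defensive.

Import Order.TTheory GRing.Theory Num.Theory.
Import numFieldNormedType.Exports.

Local Open Scope classical_set_scope.
Local Open Scope ring_scope.

(* As the library does for tuples, 'rV[R]_n carries the sigma-algebra generated
   by the coordinates, that is, the Borel sigma-algebra. *)
Section measurable_rV.
Context {R : realType} (n : nat).

Let coord (i : 'I_n) (v : 'rV[R]_n) : R := v ord0 i.

Let rV_set0 : g_sigma_preimage coord set0.
Proof. exact: sigma_algebra0. Qed.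

Let rV_setC A : g_sigma_preimage coord A -> g_sigma_preimage coord (~` A).
Proof. exact: sigma_algebraC. Qed.

Let rV_bigcup (F : (set 'rV[R]_n)^nat) :
  (forall i, g_sigma_preimage coord (F i)) ->
  g_sigma_preimage coord (\bigcup_i (F i)).
Proof. exact: sigma_algebra_bigcup. Qed.

HB.instance Definition _ :=
  @isMeasurable.Build (measure_tuple_display default_measure_display)
    'rV[R]_n (g_sigma_preimage coord) rV_set0 rV_setC rV_bigcup.

Lemma measurable_coord (i : 'I_n) :
  measurable_fun [set: 'rV[R]_n] (fun v => v ord0 i).
Proof.
move=> _ Y mY; rewrite setTI; apply: sub_sigma_algebra => /=.
rewrite -bigcup_seq/=; exists i => /=; first by rewrite mem_index_enum.
by exists Y => //; rewrite setTI.
Qed.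

Lemma measurable_fun_rVP d (T : measurableType d) (f : T -> 'rV[R]_n) :
  (forall i, measurable_fun [set: T] (fun x => f x ord0 i)) ->
  measurable_fun [set: T] f.
Proof.
move=> mf _ A mA; rewrite setTI.
have : preimage_set_system [set: T] f (g_sigma_preimage coord) (f @^-1` A).
  by exists A => //; rewrite setTI.
rewrite -(g_sigma_preimage_comp coord f).
apply: smallest_sub; first exact: sigma_algebra_measurable.
rewrite -bigcup_seq; apply: bigcup_sub => i _ B [C mC <-].
exact: mf.
Qed.

End measurable_rV.

Section lebesgue_cons.
Context {R : realType} (n : nat).

Definition rV_cons (p : measurableTypeR R * 'rV[R]_n) : 'rV[R]_n.+1 :=
  row_mx (p.1 : R)%:M p.2.

Lemma measurable_rV_cons : measurable_fun setT rV_cons.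
Proof.
apply: measurable_fun_rVP => i.
have [j ->|j ->] := split_ordP (i : 'I_(1 + n)).
  rewrite (_ : (fun _ => _) = fst); first exact: measurable_fst.
  apply/funext => p; rewrite [LHS](@row_mxEl R 1 1 n) (ord1 j) mxE.
  by rewrite eqxx mulr1n.
rewrite (_ : (fun _ => _) = (fun v : 'rV[R]_n => v ord0 j) \o snd).
  by apply: measurableT_comp; [exact: measurable_coord|exact: measurable_snd].
by apply/funext => p; rewrite [LHS](@row_mxEr R 1 1 n).
Qed.

Variable mu : {sigma_finite_measure set 'rV[R]_n -> \bar R}.

Definition lebesgue_rV_step : set 'rV[R]_n.+1 -> \bar R :=
  pushforward (lebesgue_measure \x mu)%E rV_cons.

Let mcons := measurable_rV_cons.

Let step0 : lebesgue_rV_step set0 = 0%E. Proof. exact: measure0. Qed.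

Let step_ge0 A : (0 <= lebesgue_rV_step A)%E. Proof. exact: measure_ge0. Qed.

Let step_sigma_additive : semi_sigma_additive lebesgue_rV_step.
Proof. exact: measure_semi_sigma_additive. Qed.

HB.instance Definition _ := isMeasure.Build _ _ _ lebesgue_rV_step
  step0 step_ge0 step_sigma_additive.

Let step_sigma_finite : sigma_finite setT lebesgue_rV_step.
Proof.
have [F TF Foo] : sigma_finite setT (lebesgue_measure \x mu)%E.
  have /sigma_finiteP[F [TF ndF Foo]] := sigma_finiteT (@lebesgue_measure R).
  have /sigma_finiteP[G [TG ndG Goo]] := sigma_finiteT mu.
  exists (fun k => F k `*` G k).
    rewrite -setXTT TF TG predeqE => -[x y]; split.
      move=> [/= [k _ Fkx] [l _ Gly]]; exists (maxn k l) => //; split.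
      - by move: x Fkx; exact/subsetPset/ndF/leq_maxl.
      - by move: y Gly; exact/subsetPset/ndG/leq_maxr.
    by move=> [k _ []/= ? ?]; split; exists k.
  move=> k; have [? ?] := Foo k; have [? ?] := Goo k.
  split; first exact: measurableX.
  by rewrite product_measure1E// lte_mul_pinfty// ge0_fin_numE.
pose g (v : 'rV[R]_n.+1) : measurableTypeR R * 'rV[R]_n :=
  (v ord0 ord0, @rsubmx _ 1 1 n v).
have gK p : g (rV_cons p) = p.
  rewrite /g /rV_cons row_mxKr; case: p => a v /=; congr pair.
  have -> : ord0 = lshift n ord0 :> 'I_(1 + n) by exact: val_inj.
  by rewrite [LHS](@row_mxEl R 1 1 n) mxE.
have mg : measurable_fun setT g.
  apply/measurable_fun_pairP; split; first exact: measurable_coord.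
  apply: measurable_fun_rVP => i.
  rewrite (_ : (fun _ => _) = fun v : 'rV[R]_n.+1 => v ord0 (rshift 1 i)).
    exact: measurable_coord.
  by apply/funext => v /=; rewrite mxE.
exists (fun k => g @^-1` F k); first by rewrite -preimage_bigcup -TF.
move=> k; have [mF Fk] := Foo k; split.
  by rewrite -[X in measurable X]setTI; exact: mg.
rewrite /lebesgue_rV_step /pushforward -comp_preimage.
by rewrite (_ : _ @^-1` _ = F k)//; apply/seteqP; split => p /=; rewrite gK.
Qed.

HB.instance Definition _ := Measure_isSigmaFinite.Build _ _ _ lebesgue_rV_step
  step_sigma_finite.

End lebesgue_cons.

(* Lebesgue measure on R^n, by iterating the product with the line. *)
Fixpoint lebesgue_rV {R : realType} (n : nat) :
    {sigma_finite_measure set 'rV[R]_n -> \bar R} :=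
  match n with
  | 0 => dirac (0 : 'rV[R]_0)
  | m.+1 => lebesgue_rV_step (lebesgue_rV m)
  end.

Lemma lebesgue_rV_box {R : realType} (n : nat) (A : 'I_n -> set R) :
  (forall i, measurable (A i)) ->
  lebesgue_rV n [set v : 'rV[R]_n | forall i, A i (v ord0 i)] =
  (\big[*%E/1]_(i < n) lebesgue_measure (A i))%E.
Proof.
elim: n A => [|n IHn] A mA.
  rewrite big_ord0 /= /dirac indicE mem_set//.
  by case.
rewrite big_ord_recl -IHn; last by move=> i; exact: mA.
rewrite -product_measure1E//; first congr (product_measure1 _ _ _); last first.
  rewrite (_ : [set _ | _] = \bigcap_(i in [set: 'I_n])
      ((fun v : 'rV[R]_n => v ord0 i) @^-1` A (lift ord0 i))); last first.
    by apply/seteqP; split => v /= vA i; [move=> _; exact: vA|exact: (vA i I)].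
  apply: fin_bigcap_measurable => // i _.
  by rewrite -[X in measurable X]setTI; exact: measurable_coord.
  exact: (mA ord0).
have E0 (p : measurableTypeR R * 'rV[R]_n) : rV_cons p ord0 ord0 = p.1.
  have -> : ord0 = lshift n ord0 :> 'I_(1 + n) by exact: val_inj.
  by rewrite [LHS](@row_mxEl R 1 1 n) mxE eqxx mulr1n.
have ES (p : measurableTypeR R * 'rV[R]_n) i :
    rV_cons p ord0 (lift ord0 i) = p.2 ord0 i.
  have -> : lift ord0 i = rshift 1 i :> 'I_(1 + n) by exact: val_inj.
  by rewrite [LHS](@row_mxEr R 1 1 n).
apply/seteqP; split => [p /= pA|p [/= p1 p2] i].
  by split => [|i /=]; [rewrite -E0|rewrite -ES]; exact: pA.
by case: (unliftP ord0 i) => [j|] ->; rewrite ?ES ?E0.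
Qed.

Section euclidean.
Context {R : realType} {d : nat}.
Implicit Types u v : 'rV[R]_d.

Definition dotv u v : R := \sum_(i < d) u ord0 i * v ord0 i.

(* The library norm `|v| on 'rV is the sup norm. *)
Definition enorm v : R := Num.sqrt (dotv v v).

Definition direction v : 'rV[R]_d := (enorm v)^-1 *: v.

Definition punctured_ball : set 'rV[R]_d := [set v | 0 < enorm v <= 1].

Lemma measurable_enorm : measurable_fun setT enorm.
Proof.
rewrite (_ : enorm = (fun x : R => x `^ 2^-1) \o (fun v => dotv v v)).
  apply: measurableT_comp; first exact: measurable_powR.
  apply: measurable_sum => i.
  by apply: measurable_funM; exact: measurable_coord.
apply/funext => v /=; rewrite powR12_sqrt//.
by apply: sumr_ge0 => i _; rewrite -expr2 sqr_ge0.
Qed.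

Lemma measurable_punctured_ball : measurable punctured_ball.
Proof.
rewrite (_ : punctured_ball = enorm @^-1` `]0, 1]).
  rewrite -[X in measurable X]setTI; apply: measurable_enorm => //.
by apply/seteqP; split => v /=; rewrite in_itv.
Qed.

Lemma measurable_direction : measurable_fun setT direction.
Proof.
apply: measurable_fun_rVP => i.
rewrite (_ : (fun _ => _) = fun v => (enorm v) `^ (-1) * v ord0 i).
  apply: measurable_funM; last exact: measurable_coord.
  exact: measurableT_comp (measurable_powR _) measurable_enorm.
by apply/funext => v; rewrite mxE powR_inv1// sqrtr_ge0.
Qed.

End euclidean.

(* Surface measure on the unit sphere, as a measure on R^d carried by the
   sphere: sigma(A) = d * |{r w : 0 < r <= 1, w in A}|. *)
Section surface_measure.
Context {R : realType} (d : nat).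

Definition sphere_measure : set 'rV[R]_d -> \bar R :=
  pushforward
    (mscale d%:R%:nng (mrestr (lebesgue_rV d) measurable_punctured_ball))
    direction.

Let mdir := @measurable_direction R d.

Let sphere0 : sphere_measure set0 = 0%E. Proof. exact: measure0. Qed.

Let sphere_ge0 A : (0 <= sphere_measure A)%E. Proof. exact: measure_ge0. Qed.

Let sphere_sigma_additive : semi_sigma_additive sphere_measure.
Proof. exact: measure_semi_sigma_additive. Qed.

HB.instance Definition _ := isMeasure.Build _ _ _ sphere_measure
  sphere0 sphere_ge0 sphere_sigma_additive.

End surface_measure.
Arguments sphere_measure {R} d _.

Section collision.
Context {R : realType} {d : nat}.
Implicit Types (v w sigma : 'rV[R]_d) (g f : 'rV[R]_d -> R).

Definition post_v v w sigma : 'rV[R]_d :=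
  2^-1 *: (v + w) + (enorm (w - v) / 2) *: sigma.

Definition post_w v w sigma : 'rV[R]_d :=
  2^-1 *: (v + w) - (enorm (w - v) / 2) *: sigma.

Definition cos_deviation v w sigma : R := dotv sigma (direction (v - w)).

Definition angular_kernel (s : R) (b : R -> R) : Prop :=
  [/\ measurable_fun (`[-1, 1]%classic : set R) b,
      forall c, -1 <= c <= 1 -> 0 <= b c &
      exists2 cb : R, 0 < cb & forall theta : R, 0 < theta <= pi / 2 ->
        cb^-1 * theta `^ (- 1 - 2 * s)
          <= sin theta ^+ (d - 2) * b (cos theta)
          <= cb * theta `^ (- 1 - 2 * s)].

Variables (cPhi gamma : R) (b : R -> R).

(* For gamma < 0, powR gives 0 `^ gamma = 0; this only concerns the null set
   v = w. *)
Definition collision_kernel v w sigma : R :=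
  cPhi * enorm (v - w) `^ gamma * b (cos_deviation v w sigma).

(* (x - y) ln (x / y) for nonnegative x and y *)
Definition entropy_gap (x y : R) : \bar R :=
  if (x == 0) && (y == 0) then 0%E
  else if (x == 0) || (y == 0) then +oo%E
  else ((x - y) * ln (x / y))%:E.

Definition entropy_dissipation f : \bar R :=
  ((4^-1)%:E *
   \int[lebesgue_rV d]_v \int[lebesgue_rV d]_w \int[sphere_measure d]_sigma
     (entropy_gap (f v * f w) (f (post_v v w sigma) * f (post_w v w sigma))
      * (collision_kernel v w sigma)%:E))%E.

(* <Q(f, f), phi>. As an extended real it is finite only if the positive and
   negative parts of the outer integrand have finite integrals. *)
Definition weak_collision f (phi : 'rV[R]_d -> R) : \bar R :=
  ((4^-1)%:E *
   \int[lebesgue_rV d]_v \int[lebesgue_rV d]_w \int[sphere_measure d]_sigma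
     (collision_kernel v w sigma *
      (f (post_v v w sigma) * f (post_w v w sigma) - f v * f w) *
      (phi v + phi w - phi (post_v v w sigma) - phi (post_w v w sigma)))%:E)%E.

End collision.
Arguments angular_kernel {R} d s b.

Section test_functions.
Context {R : realType} {d : nat}.

Definition partials (l : seq 'I_d) (phi : 'rV[R]_d -> R) : 'rV[R]_d -> R :=
  foldr (fun i (g : 'rV[R]_d -> R) => 'D_(delta_mx 0 i) g) phi l.

Definition Ccinfty (phi : 'rV[R]_d -> R) : Prop :=
  [/\ forall l, continuous (partials l phi),
      forall l i v, derivable (partials l phi) v (delta_mx 0 i) &
      compact (closure [set v | phi v != 0])].

(* Convergence in C_c^oo for functions supported in a common compact set *)
Definition cvg_Ccinfty (F : set_system R) (g : R -> 'rV[R]_d -> R)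
    (h : 'rV[R]_d -> R) : Prop :=
  forall l (e : R), 0 < e ->
    \forall t \near F, forall v, `|partials l (g t) v - partials l h v| < e.

(* phi is a compactly supported element of C^1([0, +oo); C_c^oo) and dphi is
   its time derivative (one-sided at t = 0). *)
Record C1_test (phi dphi : R -> 'rV[R]_d -> R) : Prop := {
  test_Ccinfty : forall t : R, 0 <= t -> Ccinfty (phi t) ;
  test_dt_Ccinfty : forall t : R, 0 <= t -> Ccinfty (dphi t) ;
  test_support : exists K : R, forall (t : R) v, 0 <= t ->
    K < t \/ K < enorm v -> phi t v = 0 ;
  test_dt : forall t : R, 0 <= t ->
    cvg_Ccinfty (within `[0, +oo[%classic t^')
      (fun t' v => (t' - t)^-1 * (phi t' v - phi t v)) (dphi t) ;
  test_dt_cont : forall t : R, 0 <= t ->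
    cvg_Ccinfty (within `[0, +oo[%classic (nbhs t)) dphi (dphi t) }.

End test_functions.

Section weak_solutions.
Context {R : realType} {d : nat}.

Definition entropy (f : 'rV[R]_d -> R) : \bar R :=
  \int[lebesgue_rV d]_v (f v * ln (f v))%:E.

Variables (cPhi gamma : R) (b : R -> R).

(* f is given by a representative that is nonnegative everywhere and jointly
   Borel; one exists for every weakly continuous curve in L^1. *)
Record H_solution (f0 : 'rV[R]_d -> R) (f : R -> 'rV[R]_d -> R) : Prop := {
  Hsol_ge0 : forall (t : R) v, 0 <= t -> 0 <= f t v ;
  Hsol_measurable :
    measurable_fun
      ([set t | 0 <= t] `*` setT : set (measurableTypeR R * 'rV[R]_d))
      (fun p : measurableTypeR R * 'rV[R]_d => f p.1 p.2) ;
  Hsol_Linfty_L12 : exists C : R, \forall t \ae lebesgue_measure, 0 <= t ->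
    (\int[lebesgue_rV d]_v ((1 + enorm v ^+ 2) * `|f t v|)%:E <= C%:E)%E ;
  Hsol_continuous : forall phi, Ccinfty phi ->
    {within `[0, +oo[%classic,
      continuous (fun t => \int[lebesgue_rV d]_v (f t v * phi v))} ;
  Hsol_initial : \forall v \ae lebesgue_rV d, f 0 v = f0 v ;
  Hsol_mass : forall t : R, 0 <= t ->
    (\int[lebesgue_rV d]_v (f t v)%:E = \int[lebesgue_rV d]_v (f0 v)%:E)%E ;
  Hsol_momentum : forall (t : R) (i : 'I_d), 0 <= t ->
    (\int[lebesgue_rV d]_v (f t v * v ord0 i)%:E
     = \int[lebesgue_rV d]_v (f0 v * v ord0 i)%:E)%E ;
  Hsol_energy : forall t : R, 0 <= t ->
    (\int[lebesgue_rV d]_v (f t v * enorm v ^+ 2)%:E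
     = \int[lebesgue_rV d]_v (f0 v * enorm v ^+ 2)%:E)%E ;
  Hsol_entropy : forall t : R, 0 <= t ->
    (entropy (f t)
     + \int[lebesgue_measure]_(tau in `[0%R, t])
         entropy_dissipation cPhi gamma b (f tau)
     <= entropy f0)%E ;
  Hsol_weak : forall phi dphi, C1_test phi dphi ->
    (- (\int[lebesgue_rV d]_v (f0 v * phi 0%R v)%:E)
     - \int[lebesgue_measure]_(t in `[0%R, +oo[)
         \int[lebesgue_rV d]_v (f t v * dphi t v)%:E
     = \int[lebesgue_measure]_(t in `[0%R, +oo[)
         weak_collision cPhi gamma b (f t) (phi t))%E }.

End weak_solutions.

(* Main.v *)
From HB Require Import structures.
Require Import Defs.
From mathcomp Require Import all_boot all_order all_algebra.
From mathcomp Require Import all_classical all_reals all_analysis.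
From mathcomp Require Import measurable_realfun ring lra.

(** For gamma >= -2 the weight |v - v_*|^(gamma+2) is bounded on the ball, and the
    claim follows from the conservation of mass. Let gamma < -2; then d >= 3, and
    beta := -(gamma + 2) lies in (0, 2 s). The proof shows that the entropy
    dissipation D(f) prevents the concentration of mass: if f has given bounds
    on mass, energy and entropy, then every ball B(w0, e) with bounded centre
    carries at most the mass

      mu(e) <= e^(2 s) (C1 D(f) + C2)                     ([mass_eball_power]).

    As beta < 2 s, summing over dyadic shells around w bounds the integral of
    f(v) |v - w|^(-beta) by a multiple of C1 D(f) + C2 ([potential_le]), and
    integrating against f(w) bounds the interaction integral at each time by
    c D(f(t)) + C. The entropy inequality makes D(f(t)) integrable in time, because
    mass and energy bound the entropy from below ([entropy_ge]).

    For the bound on mu(e), consider collisions of velocities v in B(w0, e) with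
    partners w in the bulk, that is, at a distance at least delta from w0 and
    bounded; by the entropy and energy bounds the bulk carries half of the mass
    ([bulk_mass_ge]). Restrict the collision parameter to the cap of radius
    alpha = L e around the direction of v - w. There the kernel is at least of
    order alpha^(-(d-1)-2s), and the cap has measure of order alpha^(d-1), so that
    the integral of f f_* over these collisions, weighted by this bound on the
    kernel, is at least of order alpha^(-2s) mu(e). Since
    (x - y) ln (x / y) >= x - 2 y, it is also at most 4 D(f) plus twice the same
    integral of f' f'_*. Exchanging incoming and outgoing velocities turns the
    latter into an integral over collisions that start at a distance at most
    lambda e from w0, with lambda = 1 + L rho, and that end in B(w0, e). Their
    parameters occupy a part of the sphere of measure of order e^(d-1) only,
    which gives ([grazing_estimate], [mass_eball_step])

      mu(e) / e^(2 s) <= C L^(2 s) D(f)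
                         + C L^(2 s - (d-1)) mu(lambda e) / (lambda e)^(2 s).

    Since d - 1 >= 2 > 2 s, a large L makes the last factor at most 1/2, and the
    recursion is iterated up to scales of order one ([scale_iteration]).

    The exchange of velocities ([integral_pre_post_swap]) rests on the
    behaviour of Lebesgue measure under translations and dilations: these and
    Fubini's theorem yield polar coordinates, in which the exchange interchanges
    two points of the same sphere ([polar_swap]). *)

Set Implicit Arguments.
Unset Strict Implicit.
Unset Printing Implicit Defensive.

Import Order.TTheory GRing.Theory Num.Theory.
Import numFieldNormedType.Exports.

Local Open Scope classical_set_scope.
Local Open Scope ring_scope.

(** * Lower integrals of functions that may fail to be measurable *)

Section lower_integral.
Context d (T : measurableType d) (R : realType).
Variable mu : {measure set T -> \bar R}.
Implicit Types (D S : set T) (f g h : T -> \bar R).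
Local Open Scope ereal_scope.
Import HBNNSimple.

(** The integral of a nonnegative function is a supremum over simple minorants,
    hence monotone for arbitrary functions. *)
Lemma le_lower_integral D f g : (forall x, D x -> 0 <= f x) ->
  (forall x, D x -> f x <= g x) ->
  \int[mu]_(x in D) f x <= \int[mu]_(x in D) g x.
Proof.
move=> f0 fg; rewrite !(integral_mkcond D).
have g0 x : D x -> 0 <= g x by move=> Dx; apply: le_trans (fg x Dx); exact: f0.
rewrite !ge0_integralTE; [|exact: erestrict_ge0..].
apply: ereal_sup_le => _ [h hf <-]; exists h => // x.
by apply: le_trans (hf x) _; exact: lee_restrict.
Qed.

(** A simple function below the negative part of g vanishes on S, so this part
    integrates to 0. Applied with S the unit sphere: off the sphere nothing is
    known about the sign or the measurability of the collision kernel. *)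
Lemma le_lower_integral_conull S f g : measurable S -> mu (~` S) = 0 ->
  (forall x, 0 <= f x) -> measurable_fun setT f ->
  (forall x, S x -> f x <= g x) -> \int[mu]_x f x <= \int[mu]_x g x.
Proof.
move=> mS S0 f0 mf fg; rewrite [leRHS]integralE.
have gS x : S x -> 0 <= g x by move=> Sx; apply: le_trans (fg x Sx); exact: f0.
have -> : \int[mu]_x g^\- x = 0.
  apply/eqP; rewrite eq_le integral_ge0 ?andbT//.
  apply: (@le_trans _ _ (\int[mu]_x (cst +oo \_ (~` S)) x)).
    apply: le_lower_integral => // x _; rewrite /patch; case: ifPn => [_|].
      by rewrite leey.
    by rewrite notin_setE => /contrapT /gS gx; rewrite funenegE ge_max lexx oppe_le0 gx.
  rewrite -integral_mkcond integral_cst//; last exact: measurableC.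
  by rewrite [X in _ * X]S0 mule0.
rewrite sube0 (@ae_eq_integral _ _ _ mu setT (f \_ S) f)//; first last.
- exists (~` S); split => //; first exact: measurableC.
  by move=> x /= + Sx; apply => _; rewrite patchT// inE.
- exact/(measurable_restrictT _ _).1/measurable_funTS.
apply: le_lower_integral => x _; first exact: erestrict_ge0.
have [xS|xS] := boolP (x \in S); last first.
  by rewrite patchN// funeposE le_max lexx orbT.
by rewrite patchT// funeposE le_max fg//; move: xS; rewrite inE.
Qed.

(** Each simple minorant h of g yields the measurable minorant (h - C)^+ / c
    of f. Applied in the time variable, with f the entropy dissipation. *)
Lemma lower_integral_affine_le D f g (c C : R) : measurable D ->
  (0 < c)%R -> (0 <= C)%R ->
  (forall x, D x -> 0 <= f x) -> (forall x, D x -> 0 <= g x) ->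
  (forall x, D x -> g x <= c%:E * f x + C%:E) ->
  \int[mu]_(x in D) g x <= c%:E * \int[mu]_(x in D) f x + C%:E * mu D.
Proof.
move=> mD c0 C0 f0 g0 gf; rewrite (integral_mkcond _ g) ge0_integralTE; last first.
  exact: erestrict_ge0.
apply: ge_ereal_sup => _ [h hg <-].
pose k := fun x => (c^-1%:E * maxe ((h x)%:E - C%:E) 0).
have mh : measurable_fun setT (fun x => (h x)%:E) by exact/measurable_EFinP.
have mk : measurable_fun setT k.
  apply: emeasurable_funM => //.
  by apply: measurable_maxe => //; apply: emeasurable_funB.
have k0 x : 0 <= k x.
  apply: mule_ge0; first by rewrite lee_fin invr_ge0 ltW.
  by rewrite le_max lexx orbT.
have hk x : D x -> (h x)%:E <= c%:E * k x + C%:E.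
  move=> Dx; rewrite /k muleA -EFinM divff ?gt_eqF// mul1e.
  by rewrite -leeBlDr// le_max lexx.
have h0 x : ~ D x -> (h x)%:E = 0.
  move=> Dx; apply/eqP; rewrite eq_le; apply/andP; split.
    by apply: le_trans (hg x) _; rewrite patchN// notin_setE.
  by rewrite lee_fin; exact: fun_ge0.
rewrite -integralT_nnsfun.
apply: (@le_trans _ _ (\int[mu]_(x in D) (c%:E * k x + C%:E))).
  rewrite [leRHS]integral_mkcond; apply: le_lower_integral => x _.
    by rewrite lee_fin; exact: fun_ge0.
  rewrite /patch; case: ifPn => [/[!inE]/hk//|].
  by rewrite notin_setE => /h0 ->.
rewrite ge0_integralD//; first last.
- by apply: measurable_funTS; apply: emeasurable_funM.
- by move=> x _; rewrite mule_ge0// lee_fin ltW.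
rewrite integral_cst// ge0_integralZl//; first last.
- by rewrite lee_fin ltW.
- exact: measurable_funTS.
rewrite leeD2r// lee_pmul2l// ?lte_fin//.
apply: le_lower_integral => // x Dx.
rewrite /k -(@lee_pmul2l _ c%:E) ?lte_fin// muleA -EFinM divff ?gt_eqF// mul1e.
rewrite ge_max mule_ge0 ?f0// ?lee_fin ?(ltW c0)// andbT leeBlDr//.
by apply: le_trans (gf x Dx); have := hg x; rewrite patchT// inE.
Qed.

End lower_integral.

Lemma eq_integral_conull d (T : measurableType d) (R : realType)
    (mu : {measure set T -> \bar R}) (S : set T) (f g : T -> \bar R) :
  measurable S -> mu (~` S) = 0%E ->
  (forall x, 0 <= f x)%E -> measurable_fun setT f ->
  (forall x, 0 <= g x)%E -> measurable_fun setT g ->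
  (forall x, S x -> f x = g x) -> (\int[mu]_x f x = \int[mu]_x g x)%E.
Proof.
move=> mS S0 f0 mf g0 mg fg; apply/eqP; rewrite eq_le; apply/andP; split.
  by apply: (le_lower_integral_conull mS) => // x /fg ->.
by apply: (le_lower_integral_conull mS) => // x /fg ->.
Qed.

(** * Lebesgue measure under affine maps *)

Section rV_measurability.
Context d (T : measurableType d) (R : realType) (n : nat).
Implicit Types (f g : T -> 'rV[R]_n) (k : T -> R).

Lemma measurable_rV_coord f i :
  measurable_fun setT f -> measurable_fun setT (fun x => f x ord0 i).
Proof. by move=> mf; exact: (measurableT_comp (measurable_coord i) mf). Qed.

Lemma measurable_rVD f g : measurable_fun setT f -> measurable_fun setT g ->
  measurable_fun setT (fun x => f x + g x).
Proof.
move=> mf mg; apply: measurable_fun_rVP => i.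
under eq_fun do rewrite mxE.
by apply: measurable_funD; exact: measurable_rV_coord.
Qed.

Lemma measurable_rVZ k f : measurable_fun setT k -> measurable_fun setT f ->
  measurable_fun setT (fun x => k x *: f x).
Proof.
move=> mk mf; apply: measurable_fun_rVP => i.
under eq_fun do rewrite mxE.
by apply: measurable_funM => //; exact: measurable_rV_coord.
Qed.

Lemma measurable_rVB f g : measurable_fun setT f -> measurable_fun setT g ->
  measurable_fun setT (fun x => f x - g x).
Proof.
move=> mf mg; under eq_fun do rewrite -scaleN1r.
by apply: measurable_rVD => //; apply: measurable_rVZ.
Qed.

Lemma measurable_fun_enorm f :
  measurable_fun setT f -> measurable_fun setT (fun x => enorm (f x)).
Proof. exact: (measurableT_comp measurable_enorm). Qed.

End rV_measurability.

Local Notation image_measure :=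
  measure_function.measure_function_pushforward__canonical__measure_function_Measure.

Section lebesgue_rV_affine.
Context {R : realType}.
Local Open Scope ereal_scope.

(** Both sides are measures in A that agree on half-open intervals. *)
Lemma lebesgue_measure_affine (c a : R) (A : set (measurableTypeR R)) :
  (c != 0)%R -> measurable A ->
  `|c|%:E * lebesgue_measure ((fun x : R => c * x + a)%R @^-1` A) =
  lebesgue_measure A.
Proof.
move=> c0 mA; pose phi := (fun x : measurableTypeR R => c * x + a : measurableTypeR R)%R.
have mphi : measurable_fun setT phi.
  by apply: measurable_funD => //; exact: measurable_funM.
pose k := NngNum (normr_ge0 c).
apply/esym.
refine (@lebesgue_measure_unique R
  (mscale k (pushforward lebesgue_measure phi)) _ A mA) => //.
move=> _ [[p q] _ <-] /=.
rewrite /mscale /= lebesgue_measure_itv /= lte_fin /pushforward.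
case: (ltgtP c 0%R) c0 => // c0 _.
- rewrite (_ : _ @^-1` _ = `[((q - a) / c)%R, ((p - a) / c)%R[%classic); last first.
    apply/seteqP; split => x /=; rewrite !in_itv/= /phi.
      by rewrite ler_ndivrMr// ltr_ndivlMr// ltrBlDr lerBrDr (mulrC x) andbC.
    by rewrite ler_ndivrMr// ltr_ndivlMr// ltrBlDr lerBrDr (mulrC x) andbC.
  rewrite lebesgue_measure_itv /= lte_fin ltr_nM2r ?invr_lt0// ltrD2r.
  case: ifPn => _; last by rewrite mule0.
  rewrite -!EFinB -EFinM ltr0_norm//; congr EFin.
  by field; rewrite lt_eqF.
- rewrite (_ : _ @^-1` _ = `]((p - a) / c)%R, ((q - a) / c)%R]%classic); last first.
    apply/seteqP; split => x /=; rewrite !in_itv/= /phi.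
      by rewrite ler_pdivlMr// ltr_pdivrMr// ltrBlDr lerBrDr (mulrC x).
    by rewrite ler_pdivlMr// ltr_pdivrMr// ltrBlDr lerBrDr (mulrC x).
  rewrite lebesgue_measure_itv /= lte_fin ltr_pM2r ?invr_gt0// ltrD2r.
  case: ifPn => _; last by rewrite mule0.
  rewrite -!EFinB -EFinM gtr0_norm//; congr EFin.
  by field; rewrite gt_eqF.
Unshelve. exact: mphi.
Qed.

Lemma integral_lebesgue_measure_affine (c a : R) (g : measurableTypeR R -> \bar R) :
  (c != 0)%R -> measurable_fun setT g -> (forall x, 0 <= g x) ->
  `|c|%:E * \int[lebesgue_measure]_x g (c * x + a)%R =
  \int[lebesgue_measure]_x g x.
Proof.
move=> c0 mg g0.
pose phi := (fun x : measurableTypeR R => c * x + a : measurableTypeR R)%R.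
have mphi : measurable_fun setT phi.
  by apply: measurable_funD => //; exact: measurable_funM.
pose k := NngNum (normr_ge0 c).
transitivity (\int[mscale k (image_measure lebesgue_measure mphi)]_x g x).
  by rewrite ge0_integral_mscale// ge0_integral_pushforward// preimage_setT.
apply: eq_measure_integral => A mA _; exact: lebesgue_measure_affine.
Qed.

Variable n : nat.

Lemma integral_lebesgue_rVS (g : 'rV[R]_n.+1 -> \bar R) :
  measurable_fun setT g -> (forall v, 0 <= g v) ->
  \int[lebesgue_rV n.+1]_v g v =
  \int[lebesgue_measure]_x \int[lebesgue_rV n]_v g (rV_cons (x, v)).
Proof.
move=> mg g0; rewrite ge0_integral_pushforward//. 2: exact: measurable_rV_cons.
rewrite preimage_setT fubini_tonelli1//.
  exact: (measurableT_comp mg (@measurable_rV_cons R n)).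
by move=> p; exact: g0.
Qed.

End lebesgue_rV_affine.

Section rV_cons_coordinates.
Context {R : realType} {n : nat}.
Implicit Types (p : measurableTypeR R * 'rV[R]_n).

Lemma rV_cons0 p : rV_cons p ord0 ord0 = p.1.
Proof.
have -> : ord0 = lshift n ord0 :> 'I_(1 + n) by exact: val_inj.
by rewrite [LHS](@row_mxEl R 1 1 n) mxE eqxx mulr1n.
Qed.

Lemma rV_consS p i : rV_cons p ord0 (lift ord0 i) = p.2 ord0 i.
Proof.
have -> : lift ord0 i = rshift 1 i :> 'I_(1 + n) by exact: val_inj.
by rewrite [LHS](@row_mxEr R 1 1 n).
Qed.

Lemma rV_cons_affine (c : R) (a : 'rV[R]_n.+1) x (v : 'rV[R]_n) :
  c *: rV_cons (x, v) + a =
  rV_cons (c * x + a ord0 ord0, c *: v + \row_j a ord0 (lift ord0 j)).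
Proof.
apply/rowP => i; rewrite [LHS]mxE [X in X + _]mxE.
case: (unliftP ord0 i) => [j|] ->; first by rewrite !rV_consS/= !mxE.
by rewrite !rV_cons0.
Qed.

End rV_cons_coordinates.

(** The map acts coordinatewise, so that it is affine with the same ratio on
    each slice of the iterated integral; induction on the dimension. *)
Lemma integral_lebesgue_rV_affine (R : realType) (n : nat) (c : R)
    (a : 'rV[R]_n) (g : 'rV[R]_n -> \bar R) :
  c != 0 -> measurable_fun setT g -> (forall v, 0 <= g v)%E ->
  ((`|c| ^+ n)%:E * \int[lebesgue_rV n]_v g (c *: v + a)%R =
   \int[lebesgue_rV n]_v g v)%E.
Proof.
move=> c0; elim: n a g => [|n IHn] a g mg g0.
  rewrite expr0 mul1e; apply: eq_integral => v _; congr g.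
  by apply/rowP => -[].
have maff (m : nat) (e : 'rV[R]_m) : measurable_fun setT (fun v : 'rV[R]_m => c *: v + e).
  by apply: measurable_rVD => //; apply: measurable_rVZ.
have mgcons : measurable_fun setT (g \o @rV_cons R n).
  exact: (measurableT_comp mg (@measurable_rV_cons R n)).
rewrite !integral_lebesgue_rVS//; last exact: (measurableT_comp mg (maff _ _)).
have mG : measurable_fun [set: measurableTypeR R]
    (fun x => \int[lebesgue_rV n]_v g (rV_cons (x, v)))%E.
  by apply: (measurable_fun_fubini_tonelli_F (g \o @rV_cons R n)) => // p; exact: g0.
rewrite -(integral_lebesgue_measure_affine (a ord0 ord0) c0 mG); last first.
  by move=> x; apply: integral_ge0 => v _; exact: g0.
have mGa : measurable_fun [set: measurableTypeR R]
    (fun x => \int[lebesgue_rV n]_v g (rV_cons (c * x + a ord0 ord0, v)%R))%E.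
  apply: (measurableT_comp mG).
  by apply: measurable_funD => //; exact: measurable_funM.
rewrite exprS EFinM -muleA; congr (_ * _)%E.
rewrite -ge0_integralZl//; last 2 first.
- apply: (measurable_fun_fubini_tonelli_F
    (fun p : measurableTypeR R * 'rV[R]_n => g (c *: rV_cons p + a))) => [|p].
    exact: (measurableT_comp (measurableT_comp mg (maff _ a))
    (@measurable_rV_cons R n)).
  exact: g0.
- by move=> x _; apply: integral_ge0 => v _; exact: g0.
apply: eq_integral => x _.
under eq_integral do rewrite rV_cons_affine.
rewrite (IHn _ (fun v => g (rV_cons (c * x + a ord0 ord0, v)))) => [|//|v].
- by [].
- exact: (measurableT_comp mgcons (pair1_measurable _)).
exact: g0.
Qed.

Lemma lebesgue_rV_affine (R : realType) (n : nat) (c : R) (a : 'rV[R]_n)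
    (A : set 'rV[R]_n) : c != 0 -> measurable A ->
  ((`|c| ^+ n)%:E * lebesgue_rV n ((fun v => c *: v + a)%R @^-1` A) =
   lebesgue_rV n A)%E.
Proof.
move=> c0 mA; have maff : measurable_fun setT (fun v : 'rV[R]_n => c *: v + a).
  by apply: measurable_rVD => //; apply: measurable_rVZ.
have := @integral_lebesgue_rV_affine R n c a (EFin \o \1_A) c0.
rewrite [in X in _ -> _ -> _ = X]integral_indic// setIT => <-//.
- rewrite -[in LHS](setIT (_ @^-1` _)) -integral_indic//.
  by rewrite -[X in measurable X]setTI; exact: maff.
- by apply/measurable_EFinP; exact: measurable_indic.
- by move=> v; rewrite lee_fin.
Qed.

(** * The Euclidean norm *)

Section euclidean_norm.
Context {R : realType} {d : nat}.
Implicit Types u v w : 'rV[R]_d.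

Lemma dotvC u v : dotv u v = dotv v u.
Proof. by apply: eq_bigr => i _; rewrite mulrC. Qed.

Lemma dotvDl u v w : dotv (u + v) w = dotv u w + dotv v w.
Proof. by rewrite -big_split; apply: eq_bigr => i _; rewrite mxE mulrDl. Qed.

Lemma dotvZl k u v : dotv (k *: u) v = k * dotv u v.
Proof. by rewrite mulr_sumr; apply: eq_bigr => i _; rewrite mxE mulrA. Qed.

Lemma dotvDr u v w : dotv u (v + w) = dotv u v + dotv u w.
Proof. by rewrite dotvC dotvDl !(dotvC u). Qed.

Lemma dotvZr k u v : dotv u (k *: v) = k * dotv u v.
Proof. by rewrite dotvC dotvZl dotvC. Qed.

Lemma dotv_ge0 u : 0 <= dotv u u.
Proof. by apply: sumr_ge0 => i _; rewrite -expr2 sqr_ge0. Qed.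

Lemma dotvNl u v : dotv (- u) v = - dotv u v.
Proof. by rewrite -scaleN1r dotvZl mulN1r. Qed.

Lemma dotvNr u v : dotv u (- v) = - dotv u v.
Proof. by rewrite dotvC dotvNl dotvC. Qed.

Lemma enorm_ge0 u : 0 <= enorm u. Proof. exact: sqrtr_ge0. Qed.

Lemma enorm_sqr u : enorm u ^+ 2 = dotv u u.
Proof. by rewrite sqr_sqrtr// dotv_ge0. Qed.

Lemma enormZ k u : enorm (k *: u) = `|k| * enorm u.
Proof.
rewrite /enorm dotvZl dotvZr mulrA -expr2 sqrtrM ?sqr_ge0//.
by rewrite sqrtr_sqr.
Qed.

Lemma enormN u : enorm (- u) = enorm u.
Proof. by rewrite -scaleN1r enormZ normrN1 mul1r. Qed.

Lemma enormBC u v : enorm (u - v) = enorm (v - u).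
Proof. by rewrite -enormN opprB. Qed.

Lemma enorm0 : enorm (0 : 'rV[R]_d) = 0.
Proof. by rewrite -(scale0r (0 : 'rV[R]_d)) enormZ normr0 mul0r. Qed.

Lemma enorm_eq0 u : (enorm u == 0) = (u == 0).
Proof.
apply/idP/eqP => [|->]; last by rewrite enorm0.
rewrite sqrtr_eq0 => u0.
have : dotv u u = 0 by apply/eqP; rewrite eq_le u0 dotv_ge0.
move=> /eqP; rewrite psumr_eq0 => [/allP u00|i _]; last by rewrite -expr2 sqr_ge0.
apply/rowP => i; rewrite mxE; have := u00 i (mem_index_enum i).
by rewrite -expr2 sqrf_eq0 => /eqP.
Qed.

Lemma enorm_gt0 u : (0 < enorm u) = (u != 0).
Proof. by rewrite lt_neqAle eq_sym enorm_eq0 enorm_ge0 andbT. Qed.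

Lemma enorm_subr_sqr u v :
  enorm (u - v) ^+ 2 = enorm u ^+ 2 - 2 * dotv u v + enorm v ^+ 2.
Proof.
rewrite !enorm_sqr dotvDl !dotvDr !(dotvNl, dotvNr) (dotvC v u); ring.
Qed.

Lemma dotv_le_enorm u v : dotv u v <= enorm u * enorm v.
Proof.
have [->|u0] := eqVneq u 0; first by rewrite enorm0 mul0r -(scale0r 0) dotvZl mul0r.
have [->|v0] := eqVneq v 0.
  by rewrite enorm0 mulr0 -(scale0r 0) dotvZr mul0r.
have nu : 0 < enorm u by rewrite enorm_gt0.
have nv : 0 < enorm v by rewrite enorm_gt0.
have := sqr_ge0 (enorm (enorm v *: u - enorm u *: v)).
rewrite enorm_subr_sqr dotvZl dotvZr !enormZ !ger0_norm ?enorm_ge0//.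
move=> H; have uv : 0 < enorm u * enorm v by rewrite mulr_gt0.
rewrite -(ler_pM2l uv); nra.
Qed.

Lemma ler_enormD u v : enorm (u + v) <= enorm u + enorm v.
Proof.
rewrite -(@ler_pXn2r _ 2)// ?nnegrE ?addr_ge0 ?enorm_ge0//.
have := enorm_subr_sqr u (- v); rewrite opprK dotvNr enormN => ->.
by have := dotv_le_enorm u v; rewrite sqrrD => ?; lra.
Qed.

Lemma ler_enorm_dist v u w : enorm (u - w) <= enorm (u - v) + enorm (v - w).
Proof. by have := ler_enormD (u - v) (v - w); rewrite addrA subrK. Qed.

Lemma enorm_direction u : u != 0 -> enorm (direction u) = 1.
Proof.
rewrite -enorm_gt0 => u0; rewrite /direction enormZ gtr0_norm ?invr_gt0//.
by rewrite mulVf// gt_eqF.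
Qed.

Lemma direction_enorm u : enorm u *: direction u = u.
Proof.
have [->|u0] := eqVneq u 0; first by rewrite enorm0 scale0r.
by rewrite /direction scalerA divff ?scale1r// enorm_eq0.
Qed.

Lemma direction_scale k u : 0 < k -> direction (k *: u) = direction u.
Proof.
move=> k0; rewrite /direction enormZ gtr0_norm// scalerA invfM mulrAC.
by rewrite mulVf ?gt_eqF// mul1r.
Qed.

Lemma coord_le_enorm u i : `|u ord0 i| <= enorm u.
Proof.
rewrite -sqrtr_sqr ler_sqrt ?dotv_ge0// /dotv (bigD1 i)//= -expr2 lerDl.
by apply: sumr_ge0 => j _; rewrite -expr2 sqr_ge0.
Qed.

Lemma enorm_le_sum u : enorm u <= \sum_(i < d) `|u ord0 i|.
Proof.
rewrite -[leRHS]ger0_norm ?sumr_ge0// -sqrtr_sqr ler_sqrt ?sqr_ge0//.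
rewrite expr2 mulr_suml ler_sum// => i _.
have ui : `|u ord0 i| <= \sum_(j < d) `|u ord0 j|.
  by rewrite (bigD1 i)//= lerDl sumr_ge0.
by apply: le_trans (ler_norm _) _; rewrite normrM ler_wpM2l.
Qed.

Definition eball v (r : R) : set 'rV[R]_d := [set u | enorm (u - v) < r].

Lemma measurable_eball v r : measurable (eball v r).
Proof.
rewrite (_ : eball v r = (fun u => enorm (u - v)) @^-1` `]-oo, r[).
  rewrite -[X in measurable X]setTI; apply: measurable_fun_enorm => //.
  exact: measurable_rVB.
by apply/seteqP; split => u /=; rewrite in_itv.
Qed.

End euclidean_norm.

(** * Volumes of balls, cones and spherical caps *)

Section ball_measure.
Context {R : realType} {d : nat}.
Implicit Types (u v : 'rV[R]_d) (r : R).

Lemma lebesgue_eball v r : 0 < r ->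
  lebesgue_rV d (eball v r) = ((r ^+ d)%:E * lebesgue_rV d (eball 0%R 1))%E.
Proof.
move=> r0; rewrite -(@lebesgue_rV_affine R d r v (eball v r)) ?gt_eqF//; last first.
  exact: measurable_eball.
rewrite gtr0_norm//; congr (_ * lebesgue_rV d _)%E.
apply/seteqP; split => u /=; rewrite /eball /= subr0 addrK enormZ gtr0_norm//.
  by rewrite gtr_pMr.
by rewrite gtr_pMr.
Qed.

Let cube c : set 'rV[R]_d := [set v | forall i, `[- c, c]%classic (v ord0 i)].

Let lebesgue_cube c : 0 < c -> lebesgue_rV d (cube c) = ((c + c) ^+ d)%:E.
Proof.
move=> c0; rewrite (lebesgue_rV_box (A := fun=> `[- c, c]%classic))//.
rewrite lebesgue_measure_itv/= lte_fin gtrN// -EFinB opprK big_const cardE size_enum_ord.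
elim: d => //= n ->; rewrite exprS EFinM//.
Qed.

Let measurable_cube c : measurable (cube c).
Proof.
rewrite (_ : cube c = \bigcap_(i in [set: 'I_d])
    ((fun v : 'rV[R]_d => v ord0 i) @^-1` `[- c, c]%classic)).
  apply: fin_bigcap_measurable => // i _.
  by rewrite -[X in measurable X]setTI; exact: measurable_coord.
by apply/seteqP; split => v /= vA i; [move=> _; exact: vA|exact: (vA i I)].
Qed.

Definition ball_volume : R := fine (lebesgue_rV d (eball (0 : 'rV[R]_d) 1)).

Lemma lebesgue_unit_ball_lty : (lebesgue_rV d (eball (0 : 'rV[R]_d) 1) < +oo)%E.
Proof.
apply: (@le_lt_trans _ _ (lebesgue_rV d (cube 1))); last by rewrite lebesgue_cube// ltry.
apply: le_measure; rewrite ?inE; [exact: measurable_eball|exact: measurable_cube|].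
move=> v /=; rewrite /eball /= subr0 => /ltW v1 i; rewrite /= in_itv/= -ler_norml.
exact: le_trans (coord_le_enorm v i) v1.
Qed.

Lemma lebesgue_unit_ball : lebesgue_rV d (eball (0 : 'rV[R]_d) 1) = ball_volume%:E.
Proof. by rewrite fineK// ge0_fin_numE// lebesgue_unit_ball_lty. Qed.

Lemma ball_volume_gt0 : 0 < ball_volume.
Proof.
rewrite -lte_fin -lebesgue_unit_ball; pose c : R := d.+1%:R^-1.
have c0 : 0 < c by rewrite invr_gt0 ltr0n.
apply: (@lt_le_trans _ _ (lebesgue_rV d (cube c))).
  by rewrite lebesgue_cube// lte_fin exprn_gt0// addr_gt0.
apply: le_measure; rewrite ?inE; [exact: measurable_cube|exact: measurable_eball|].
move=> v /= vc; rewrite /eball /= subr0; apply: le_lt_trans (enorm_le_sum v) _.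
apply: (@le_lt_trans _ _ (\sum_(i < d) c)).
  by apply: ler_sum => i _; have := vc i; rewrite /= in_itv/= -ler_norml.
rewrite sumr_const card_ord -mulr_natl -ltr_pdivlMr ?invr_gt0//.
by rewrite invrK mul1r ltr_nat.
Qed.

Lemma lebesgue_eballE v r : 0 < r ->
  lebesgue_rV d (eball v r) = (r ^+ d * ball_volume)%:E.
Proof. by move=> r0; rewrite lebesgue_eball// lebesgue_unit_ball EFinM. Qed.

End ball_measure.
Arguments ball_volume R d : clear implicits.

Section cones.
Context {R : realType} {d : nat}.
Hypothesis d_gt0 : (0 < d)%N.
Implicit Types (u v e : 'rV[R]_d) (r : R) (S : set 'rV[R]_d).

Definition cone S r := [set v : 'rV[R]_d | 0 < enorm v <= r /\ S (direction v)].

Lemma measurable_cone S r : measurable S -> measurable (cone S r).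
Proof.
move=> mS; rewrite (_ : cone S r = (enorm @^-1` `]0, r]) `&` direction @^-1` S).
  apply: measurableI; rewrite -[X in measurable X]setTI.
    exact: measurable_enorm.
  exact: measurable_direction.
by apply/seteqP; split => v /=; rewrite in_itv.
Qed.

Lemma lebesgue_cone S r : measurable S -> 0 < r ->
  lebesgue_rV d (cone S r) = ((r ^+ d)%:E * lebesgue_rV d (cone S 1))%E.
Proof.
move=> mS r0; rewrite -(@lebesgue_rV_affine R d r 0 (cone S r)) ?gt_eqF//; last first.
  exact: measurable_cone.
rewrite gtr0_norm//; congr (_ * lebesgue_rV d _)%E.
apply/seteqP; split => u /=; rewrite /cone /= addr0 enormZ gtr0_norm// direction_scale//.
  by rewrite pmulr_rgt0// ger_pMr.
by rewrite pmulr_rgt0// ger_pMr.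
Qed.

Lemma lebesgue_cone_lty S : measurable S -> (lebesgue_rV d (cone S 1) < +oo)%E.
Proof.
move=> mS; apply: (@le_lt_trans _ _ (lebesgue_rV d (eball (0 : 'rV[R]_d) 2))).
  apply: le_measure; rewrite ?inE; [exact: measurable_cone|exact: measurable_eball|].
  by move=> v [/andP[_ v1] _]; rewrite /eball /= subr0 (le_lt_trans v1)// ltr1n.
by rewrite lebesgue_eballE// ltry.
Qed.

(** By homogeneity a shell of the cone carries a fixed share of its volume. *)
Lemma lebesgue_cone_shell S r : measurable S -> 0 < r < 1 ->
  (lebesgue_rV d (cone S 1 `\` cone S (1 - r)) =
   (1 - (1 - r) ^+ d)%:E * lebesgue_rV d (cone S 1))%E.
Proof.
move=> mS /andP[r0 r1]; have r10 : 0 < 1 - r by rewrite subr_gt0.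
have -> : lebesgue_rV d (cone S 1 `\` cone S (1 - r)) =
    (lebesgue_rV d (cone S 1) - lebesgue_rV d (cone S (1 - r)))%E.
  rewrite measureD; [|exact: measurable_cone..|exact: lebesgue_cone_lty].
  rewrite setIidr// => v [/andP[v0 vr] Sv]; split => //.
  by rewrite v0/= (le_trans vr)// gerBl ltW.
rewrite (lebesgue_cone mS r10).
have := lebesgue_cone_lty mS; rewrite -ge0_fin_numE// => /fineK <-.
by rewrite -!EFinM -EFinB; congr EFin; ring.
Qed.

End cones.

Section sphere_measure_bounds.
Context {R : realType} {d : nat}.
Hypothesis d_gt0 : (0 < d)%N.
Implicit Types (u v e p : 'rV[R]_d) (r : R) (S : set 'rV[R]_d).

Lemma sphere_measureE S : measurable S ->
  sphere_measure d S = (d%:R%:E * lebesgue_rV d (cone S 1))%E.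
Proof.
move=> mS; rewrite /sphere_measure /pushforward /mscale /= /mrestr.
congr (_ * lebesgue_rV d _)%E.
by apply/seteqP; split => v /=; [move=> [? ?]|move=> [? ?]].
Qed.

(** The shell of relative thickness r of the cone over S lies in a ball of
    radius 2 r, and it carries at least the share r of the cone. *)
Lemma sphere_measure_le S p r : measurable S -> 0 < r < 1 ->
  (forall v, enorm v = 1 -> S v -> enorm (v - p) < r) ->
  (sphere_measure d S <= (d%:R * 2 ^+ d * ball_volume R d * r ^+ d.-1)%:E)%E.
Proof.
move=> mS r01 Sp; have /andP[r0 r1] := r01; rewrite sphere_measureE//.
have : (lebesgue_rV d (cone S 1 `\` cone S (1 - r)) <=
        lebesgue_rV d (eball p (2 * r)))%E.
  apply: le_measure; rewrite ?inE.
  - by apply: measurableD; exact: measurable_cone.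
  - exact: measurable_eball.
  move=> v [[/andP[v0 v1] Sv]] nv; rewrite /eball /=.
  have v_neq0 : v != 0 by rewrite -enorm_gt0.
  have vr : 1 - r < enorm v.
    by rewrite ltNge; apply/negP => vr; apply: nv; split => //; rewrite v0.
  apply: le_lt_trans (ler_enorm_dist (direction v) _ _) _.
  have := Sp _ (enorm_direction v_neq0) Sv.
  suff : enorm (v - direction v) <= r by move=> *; lra.
  rewrite -{1}(direction_enorm v) -{2}(scale1r (direction v)) -scalerBl enormZ.
  by rewrite enorm_direction// mulr1 ler0_norm; lra.
rewrite lebesgue_cone_shell// lebesgue_eballE ?mulr_gt0//.
have := lebesgue_cone_lty mS; rewrite -ge0_fin_numE// => /fineK <-.
rewrite -!EFinM !lee_fin; set c := fine _ => H.
have c0 : 0 <= c by rewrite fine_ge0.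
have : (1 - r) ^+ d <= 1 - r by rewrite -[leRHS]expr1 ler_wiXn2l//; lra.
move=> Hr; rewrite -(ler_pM2l r0).
apply: (@le_trans _ _ (d%:R * ((2 * r) ^+ d * ball_volume R d))).
  rewrite mulrCA ler_wpM2l//; apply: le_trans H; rewrite ler_wpM2r//; lra.
have rd : r ^+ d = r * r ^+ d.-1 by rewrite -exprS prednK.
rewrite exprMn rd.
by rewrite le_eqVlt; apply/orP; left; apply/eqP; ring.
Qed.

(** Conversely, the shell over a cap of radius r contains a ball of radius
    r / 4, and by Bernoulli it carries at most the share d r of the cone. *)
Lemma sphere_measure_ge S e r : measurable S -> 0 < r < 1 -> enorm e = 1 ->
  (forall v, enorm v = 1 -> enorm (v - e) <= r -> S v) ->
  ((4 ^- d * ball_volume R d * r ^+ d.-1)%:E <= sphere_measure d S)%E.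
Proof.
move=> mS r01 e1 Se; have /andP[r0 r1] := r01; rewrite sphere_measureE//.
have : (lebesgue_rV d (eball ((1 - r / 4) *: e) (r / 4)) <=
        lebesgue_rV d (cone S 1 `\` cone S (1 - r)))%E.
  apply: le_measure; rewrite ?inE.
  - exact: measurable_eball.
  - by apply: measurableD; exact: measurable_cone.
  move=> v; rewrite /eball /= => vr.
  have ne : enorm ((1 - r / 4) *: e) = 1 - r / 4.
    by rewrite enormZ e1 mulr1 gtr0_norm//; lra.
  have v1 : enorm v <= 1.
    have := ler_enorm_dist ((1 - r / 4) *: e) v 0; rewrite !subr0 ne => ?; lra.
  have vr1 : 1 - r / 2 <= enorm v.
    have := ler_enorm_dist v ((1 - r / 4) *: e) 0; rewrite !subr0 ne enormBC => ?; lra.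
  have v0 : 0 < enorm v by lra.
  have v_neq0 : v != 0 by rewrite -enorm_gt0.
  split; last by move=> [/andP[_ ?] _]; lra.
  split; first by rewrite v0.
  apply: Se; first exact: enorm_direction.
  have dv : enorm (direction v - v) <= r / 2.
    rewrite -{2}(direction_enorm v) -{1}(scale1r (direction v)) -scalerBl enormZ.
    by rewrite enorm_direction// mulr1 ger0_norm; lra.
  have ve : enorm ((1 - r / 4) *: e - e) = r / 4.
    rewrite -{2}(scale1r e) -scalerBl enormZ e1 mulr1 ler0_norm; lra.
  have := ler_enorm_dist v (direction v) e.
  have := ler_enorm_dist ((1 - r / 4) *: e) v e; lra.
rewrite lebesgue_cone_shell// lebesgue_eballE ?divr_gt0//.
have := lebesgue_cone_lty mS; rewrite -ge0_fin_numE// => /fineK <-.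
rewrite -!EFinM !lee_fin; set c := fine _ => H.
have c0 : 0 <= c by rewrite fine_ge0.
have Hr : 1 - (1 - r) ^+ d <= d%:R * r.
  have : forall n, 1 - n%:R * r <= (1 - r) ^+ n.
    elim=> [|n IHn]; first by rewrite expr0 mul0r subr0.
    have n0 : 0 <= n%:R :> R by [].
    rewrite exprS -natr1; have : 0 <= 1 - r by lra.
    by move=> /(ler_wpM2l)/(_ _ _ IHn); nra.
  by move=> /(_ d) ?; lra.
rewrite -(ler_pM2l r0).
apply: (@le_trans _ _ ((r / 4) ^+ d * ball_volume R d)).
  have rd : r ^+ d = r * r ^+ d.-1 by rewrite -exprS prednK.
  rewrite expr_div_n rd.
  by rewrite le_eqVlt; apply/orP; left; apply/eqP; ring.
apply: le_trans H _; rewrite mulrA ler_wpM2r// mulrC; lra.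
Qed.

Lemma measurable_unit_sphere : measurable [set v : 'rV[R]_d | enorm v = 1].
Proof.
rewrite (_ : [set _ | _] = enorm @^-1` [set 1])//.
by rewrite -[X in measurable X]setTI; exact: measurable_enorm.
Qed.

Lemma sphere_measure_conull :
  sphere_measure d (~` [set v : 'rV[R]_d | enorm v = 1]) = 0%E.
Proof.
rewrite sphere_measureE; last by apply: measurableC; exact: measurable_unit_sphere.
rewrite (_ : cone _ _ = set0) ?measure0 ?mule0//.
apply/seteqP; split => v //= [/andP[v0 _]]; apply.
by rewrite /= enorm_direction// -enorm_gt0.
Qed.

Lemma sphere_measure_lty : (sphere_measure d [set: 'rV[R]_d] < +oo)%E.
Proof.
rewrite sphere_measureE// lte_mul_pinfty ?lee_fin//.
exact: lebesgue_cone_lty.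
Qed.

End sphere_measure_bounds.

(** * Polar coordinates *)

Section sphere_integral.
Context {R : realType} {d : nat}.

Let sphere_measure_fin : fin_num_fun (@sphere_measure R d).
Proof.
move=> U mU; rewrite ge0_fin_numE//.
apply: le_lt_trans (@sphere_measure_lty R d).
by apply: le_measure; rewrite ?inE.
Qed.

HB.instance Definition _ :=
  Measure_isFinite.Build _ _ _ (@sphere_measure R d) sphere_measure_fin.

Lemma ge0_integral_sphere (g : 'rV[R]_d -> \bar R) :
  measurable_fun setT g -> (forall v, 0 <= g v)%E ->
  (\int[sphere_measure d]_v g v =
   d%:R%:E * \int[lebesgue_rV d]_v
     ((\1_(@punctured_ball R d) v)%:E * g (direction v)))%E.
Proof.
move=> mg g0; have mP := @measurable_punctured_ball R d.
have mdir := @measurable_direction R d.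
have mgd : measurable_fun setT (g \o direction) by exact: measurableT_comp.
rewrite ge0_integral_pushforward// preimage_setT ge0_integral_mscale//; last first.
  by move=> x _; exact: g0.
congr (_ * _)%E.
have m1 : measurable_fun setT (fun v : 'rV[R]_d => (\1_(@punctured_ball R d) v)%:E : \bar R).
  by apply/measurable_EFinP; exact: measurable_indic.
have Pv v : ((\1_(@punctured_ball R d) v)%:E * g (direction v) =
    ((g \o direction) \_ (@punctured_ball R d)) v)%E.
  rewrite indicE /patch; case: ifPn => _; rewrite ?mul1e ?mul0e//.
have E1 : (\int[mrestr (lebesgue_rV d) mP]_x (g \o direction) x =
    \int[mrestr (lebesgue_rV d) mP]_(x in @punctured_ball R d) (g \o direction) x)%E.
  rewrite [RHS]integral_mkcond; apply: (eq_integral_conull mP).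
  - by rewrite -(measure0 (lebesgue_rV d)) -(setICl (@punctured_ball R d)).
  - by move=> x; exact: g0.
  - by [].
  - by apply: erestrict_ge0 => x _; exact: g0.
  - by apply/(measurable_restrictT _ _).1 => //; exact: measurable_funTS.
  - by move=> x Px; rewrite patchT// inE.
rewrite E1 (@eq_measure_integral _ _ _ _ (lebesgue_rV d)); last first.
  by move=> A mA AP; rewrite -{2}(setIidl AP).
by rewrite integral_mkcond; apply: eq_integral => v _; rewrite Pv.
Qed.

End sphere_integral.

Lemma measurable_invr (R : realType) :
  measurable_fun [set: R] (fun x : R => x^-1).
Proof.
rewrite (_ : (fun _ => _) = fun x : R => x * (x ^+ 2) `^ (-1)).
  apply: measurable_funM => //.
  by apply: (measurableT_comp (measurable_powR _)); exact: measurable_funX.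
apply/funext => x; rewrite powR_inv1 ?sqr_ge0//.
by have [->|x0] := eqVneq x 0; [rewrite invr0 mul0r|field].
Qed.

Section polar_coordinates.
Context {R : realType} {d : nat}.
Hypothesis d_gt0 : (0 < d)%N.
Local Notation rV := 'rV[R]_d.
Local Notation P := (@punctured_ball R d).

(** The density r^(d-1) on the half-line r > 0. *)
Definition radial_weight (r : R) : R := \1_(`]0, +oo[%classic) r * r ^+ d.-1.
Local Notation w := radial_weight.

Lemma radial_weight_gt0 (r : R) : 0 < r -> w r = r ^+ d.-1.
Proof. by move=> r0; rewrite /w indicE mem_set ?mul1r//= in_itv/= r0. Qed.

Lemma radial_weight_le0 (r : R) : r <= 0 -> w r = 0.
Proof.
move=> r0; rewrite /w indicE memNset ?mul0r//= in_itv/= andbT.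
by apply/negP; rewrite -leNgt.
Qed.

Lemma radial_weight_ge0 (r : R) : 0 <= w r.
Proof.
have [r0|r0] := ltP 0 r; last by rewrite radial_weight_le0.
by rewrite radial_weight_gt0// exprn_ge0// ltW.
Qed.

Lemma measurable_radial_weight :
  measurable_fun [set: measurableTypeR R] (w : measurableTypeR R -> R).
Proof.
apply: measurable_funM; first exact: measurable_indic.
exact: measurable_funX.
Qed.

Let m1P : measurable_fun setT (\1_P : rV -> R).
Proof. by apply: measurable_indic; exact: measurable_punctured_ball. Qed.

Let mdir := @measurable_direction R d.

Let mnorm := @measurable_enorm R d.

Let inP (x : rV) : 0 < enorm x <= 1 -> \1_P x = 1 :> R.
Proof. by move=> Px; rewrite indicE mem_set. Qed.

Let ninP (x : rV) : ~ (0 < enorm x <= 1) -> \1_P x = 0 :> R.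
Proof. by move=> Px; rewrite indicE memNset. Qed.

Variable psi : rV -> \bar R.
Hypothesis mpsi : measurable_fun setT psi.
Hypothesis psi0 : forall v, (0 <= psi v)%E.

Let F (p : measurableTypeR R * rV) : \bar R :=
  ((w p.1 * \1_P p.2)%:E * psi (p.1 *: direction p.2)%R)%E.
Let G (p : measurableTypeR R * rV) : \bar R :=
  ((w p.1 * (\1_P p.2 * enorm p.2 ^+ d))%:E * psi (p.1 *: p.2)%R)%E.
Let h (p : measurableTypeR R * rV) : R :=
  w p.1 * (\1_P (p.1^-1 *: p.2) * ((p.1^-1 * enorm p.2) ^+ d * p.1^-1 ^+ d)).
Let H (p : measurableTypeR R * rV) : \bar R := ((h p)%:E * psi p.2)%E.

Let mw : measurable_fun setT (fun p : measurableTypeR R * rV => w p.1).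
Proof. exact: (measurableT_comp measurable_radial_weight measurable_fst). Qed.

Let minv : measurable_fun setT (fun p : measurableTypeR R * rV => (p.1 : R)^-1).
Proof. exact: (measurableT_comp (@measurable_invr R) measurable_fst). Qed.

Let mF : measurable_fun setT F.
Proof.
apply: emeasurable_funM.
  apply/measurable_EFinP/measurable_funM; first exact: mw.
  exact: (measurableT_comp m1P measurable_snd).
apply: (measurableT_comp mpsi); apply: measurable_rVZ; first exact: measurable_fst.
exact: (measurableT_comp mdir measurable_snd).
Qed.

Let mG : measurable_fun setT G.
Proof.
apply: emeasurable_funM.
  apply/measurable_EFinP/measurable_funM; first exact: mw.
  apply: measurable_funM; first exact: (measurableT_comp m1P measurable_snd).
  by apply: measurable_funX; exact: (measurableT_comp mnorm measurable_snd).
by apply: (measurableT_comp mpsi); apply: measurable_rVZ.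
Qed.

Let mh : measurable_fun setT h.
Proof.
apply: measurable_funM => //; apply: measurable_funM.
  by apply: (measurableT_comp m1P); exact: measurable_rVZ.
apply: measurable_funM; apply: measurable_funX => //.
by apply: measurable_funM => //; exact: (measurableT_comp mnorm measurable_snd).
Qed.

Let mH : measurable_fun setT H.
Proof.
apply: emeasurable_funM; first exact/measurable_EFinP.
exact: (measurableT_comp mpsi measurable_snd).
Qed.

Let F0 p : (0 <= F p)%E.
Proof. by rewrite mule_ge0// lee_fin mulr_ge0// radial_weight_ge0. Qed.

Let G0 p : (0 <= G p)%E.
Proof.
rewrite mule_ge0// lee_fin mulr_ge0 ?radial_weight_ge0// mulr_ge0//.
by rewrite exprn_ge0// enorm_ge0.
Qed.

Let h0 p : 0 <= h p.
Proof.
have [r0|r0] := ltP 0 (p.1 : R); last by rewrite /h radial_weight_le0// mul0r.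
rewrite mulr_ge0 ?radial_weight_ge0// mulr_ge0// mulr_ge0// exprn_ge0//.
  by rewrite mulr_ge0 ?enorm_ge0// invr_ge0 ltW.
by rewrite invr_ge0 ltW.
Qed.

Let H0 p : (0 <= H p)%E.
Proof. by rewrite mule_ge0// lee_fin. Qed.

(** The integral of t^(-d-1) over t >= 1. *)
Definition polar_constant : \bar R :=
  (\int[lebesgue_measure]_t (w t * (\1_(`[1, +oo[%classic) t * t^-1 ^+ d * t^-1 ^+ d))%:E)%E.

(* Substitution r = |x| t. *)
Let stepFG x : (\int[lebesgue_measure]_r F (r, x) =
                \int[lebesgue_measure]_t G (t, x))%E.
Proof.
have [Px|Px] := pselect (0 < enorm x <= 1); last first.
  by rewrite !integral0_eq// => r _; rewrite /F /G /= ninP// ?mul0r !mulr0 mul0e.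
have /andP[x0 x1] := Px.
rewrite -(@integral_lebesgue_measure_affine R (enorm x) 0) ?gt_eqF//; last first.
  exact: (measurableT_comp mF (pair2_measurable _)).
rewrite -ge0_integralZl ?lee_fin//; last first.
  apply: (measurableT_comp (measurableT_comp mF (pair2_measurable _))).
  by apply: measurable_funD => //; exact: measurable_funM.
apply: eq_integral => t _; rewrite /F /G /= addr0 inP//.
rewrite (mulrC (enorm x)) -scalerA direction_enorm muleA -EFinM; congr (_%:E * _)%E.
rewrite gtr0_norm//; have [t0|t0] := ltP 0 t.
  rewrite !radial_weight_gt0 ?mulr_gt0// exprMn.
  have -> : enorm x ^+ d = enorm x * enorm x ^+ d.-1 by rewrite -exprS prednK.
  by ring.
by rewrite !radial_weight_le0 ?pmulr_lle0// !(mul0r, mulr0).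
Qed.

(* Substitution y = t x. *)
Let stepGH t : (\int[lebesgue_rV d]_x G (t, x) =
                \int[lebesgue_rV d]_y H (t, y))%E.
Proof.
have [t0|t0] := ltP 0 (t : R); last first.
  by rewrite !integral0_eq// => x _; rewrite /G /H /h /= radial_weight_le0// !mul0r mul0e.
rewrite -(@integral_lebesgue_rV_affine R d t 0 (fun y => H (t, y))) ?gt_eqF//; last first.
  exact: (measurableT_comp mH (pair1_measurable _)).
rewrite -ge0_integralZl ?lee_fin//; last first.
  apply: (measurableT_comp (measurableT_comp mH (pair1_measurable _))).
  by apply: measurable_rVD => //; exact: measurable_rVZ.
apply: eq_integral => x _; rewrite /G /H /h /= addr0 scalerA mulVf ?gt_eqF// scale1r.
rewrite muleA -EFinM enormZ gtr0_norm// mulKf ?gt_eqF//; congr (_%:E * _)%E.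
by rewrite exprVn; field; rewrite gt_eqF// exprn_gt0.
Qed.

(* Substitution t = |y| tau, which removes y from the integral. *)
Let steph y : y != 0 ->
  (\int[lebesgue_measure]_t (h (t, y))%:E = polar_constant)%E.
Proof.
rewrite -enorm_gt0 => y0.
rewrite -(@integral_lebesgue_measure_affine R (enorm y) 0) ?gt_eqF//; last 2 first.
- by apply/measurable_EFinP; exact: (measurableT_comp mh (pair2_measurable _)).
- by move=> x; rewrite lee_fin.
rewrite -ge0_integralZl ?lee_fin//; last 2 first.
- apply/measurable_EFinP.
  apply: (measurableT_comp (measurableT_comp mh (pair2_measurable y))).
  by apply: measurable_funD => //; exact: measurable_funM.
- by move=> x _; rewrite lee_fin.
apply: eq_integral => t _; rewrite -EFinM; congr EFin.
rewrite /h /= addr0 gtr0_norm//; have [t0|t0] := ltP 0 t; last first.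
  by rewrite !radial_weight_le0 ?pmulr_rle0// !mul0r mulr0.
have yt : 0 < (enorm y * t)^-1 by rewrite invr_gt0 mulr_gt0.
have -> : \1_P ((enorm y * t)^-1 *: y) = \1_(`[1, +oo[%classic) t :> R.
  rewrite !indicE; congr ((nat_of_bool _)%:R); apply/idP/idP; rewrite !inE /= /punctured_ball /=.
    rewrite enormZ (gtr0_norm yt) => /andP[_].
    by rewrite invfM mulrAC mulVf ?gt_eqF// mul1r in_itv/= andbT invf_le1.
  rewrite enormZ (gtr0_norm yt) in_itv/= andbT => t1.
  by rewrite invfM mulrAC mulVf ?gt_eqF// mul1r invr_gt0 t0 invf_le1.
have -> : (enorm y * t)^-1 * enorm y = t^-1 by field; rewrite !gt_eqF.
rewrite !radial_weight_gt0 ?mulr_gt0// invfM.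
rewrite !exprMn !exprVn.
have -> : enorm y ^+ d = enorm y * enorm y ^+ d.-1 by rewrite -exprS prednK.
by field; rewrite !gt_eqF// exprn_gt0.
Qed.

Let lebesgue_origin : lebesgue_rV d (~` [set v : rV | v != 0]) = 0%E.
Proof.
pose A (i : 'I_d) : set (measurableTypeR R) := [set (0 : R)].
rewrite (_ : ~` _ = [set v : rV | forall i, A i (v ord0 i)]).
  rewrite lebesgue_rV_box; last by move=> i; exact: measurable_set1.
  rewrite (eq_bigr (fun=> 0%E)); last first.
    by move=> i _; rewrite lebesgue_measure_set1.
  have big0 n : (0 < n)%N -> (\big[*%E/1]_(i < n) (0 : \bar R) = 0)%E.
    by case: n => // n _; rewrite big_ord_recl mul0e.
  exact: big0.
apply/seteqP; split => v /=.
  by move=> /negP/negPn/eqP -> i; rewrite /A /= mxE.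
by move=> v0; apply/negP/negPn/eqP/rowP => i; rewrite mxE; exact: v0.
Qed.

(** The sphere integral is an integral over the punctured unit ball. For each
    point x of the ball the radial variable is rescaled by |x|; after exchanging
    the integrals, x is rescaled to y = t x, and what multiplies psi y is an
    integral over t that scales out to a constant. *)
Lemma polar_coordinates_scaled :
  (\int[lebesgue_measure]_r ((w r)%:E * \int[sphere_measure d]_v psi (r *: v)%R) =
   d%:R%:E * polar_constant * \int[lebesgue_rV d]_v psi v)%E.
Proof.
transitivity (d%:R%:E * \int[lebesgue_measure]_r \int[lebesgue_rV d]_x F (r, x))%E.
  rewrite -ge0_integralZl ?lee_fin//; last 2 first.
  - exact: (measurable_fun_fubini_tonelli_F F).
  - by move=> r _; apply: integral_ge0.
  apply: eq_integral => r _.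
  rewrite ge0_integral_sphere//; last first.
    by apply: (measurableT_comp mpsi); exact: measurable_rVZ.
  rewrite muleCA; congr (_ * _)%E.
  rewrite -ge0_integralZl ?lee_fin ?radial_weight_ge0//; last 2 first.
  - apply: emeasurable_funM; first exact/measurable_EFinP.
    by apply: (measurableT_comp mpsi); exact: measurable_rVZ.
  - by move=> x _; rewrite mule_ge0// lee_fin.
  by apply: eq_integral => x _; rewrite /F /= muleA -EFinM.
rewrite -muleA; congr (_ * _)%E.
rewrite (fubini_tonelli F)//; under eq_integral do rewrite stepFG.
rewrite -(fubini_tonelli G)//; under eq_integral do rewrite stepGH.
rewrite (fubini_tonelli H)//.
have k0 : (0 <= polar_constant)%E.
  apply: integral_ge0 => t _; rewrite lee_fin mulr_ge0 ?radial_weight_ge0//.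
  by rewrite -mulrA mulr_ge0// -expr2 sqr_ge0.
rewrite -ge0_integralZl//.
have mO : measurable [set v : rV | v != 0].
  rewrite (_ : [set _ | _] = enorm @^-1` `]0, +oo[).
    by rewrite -[X in measurable X]setTI; exact: mnorm.
  by apply/seteqP; split => v /=; rewrite in_itv/= andbT enorm_gt0.
apply: (eq_integral_conull mO lebesgue_origin).
- by move=> y; exact: integral_ge0.
- exact: (measurable_fun_fubini_tonelli_G H).
- by move=> y; rewrite mule_ge0.
- exact: measurable_funeM.
move=> y y0; rewrite -(steph y0) -ge0_integralZr//.
- by apply/measurable_EFinP; exact: (measurableT_comp mh (pair2_measurable _)).
- by move=> t _; rewrite lee_fin.
Qed.

End polar_coordinates.

Lemma mule_pinj (R : realDomainType) (c : R) (x y : \bar R) :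
  0 < c -> (c%:E * x = c%:E * y)%E -> x = y.
Proof.
move=> c0 cxy; apply/eqP; rewrite eq_le.
by rewrite -(@lee_pmul2l _ c%:E)// -[X in _ && X](@lee_pmul2l _ c%:E)// cxy lexx.
Qed.

Section polar_swap.
Context {R : realType} {d : nat}.
Hypothesis d_gt0 : (0 < d)%N.
Local Notation rV := 'rV[R]_d.
Local Notation w := (@radial_weight R d).
Local Notation k := (@polar_constant R d).

Lemma polar_constant_gt0 : (0 < k)%E.
Proof.
pose c : R := 2^-1 ^+ d * 2^-1 ^+ d.
have c0 : 0 < c by rewrite mulr_gt0// exprn_gt0.
apply: (@lt_le_trans _ _
  (\int[lebesgue_measure]_(t in `[1%R, 2%R]) c%:E)%E).
  rewrite integral_cst//= lebesgue_measure_itv/= lte_fin ltr1n -EFinB.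
  by apply: mule_gt0; rewrite lte_fin//; lra.
rewrite integral_mkcond; apply: le_lower_integral => t _.
  by apply: erestrict_ge0 => x _; rewrite lee_fin ltW.
rewrite /patch; case: ifPn => [|_]; last first.
  rewrite lee_fin mulr_ge0 ?radial_weight_ge0//.
  by rewrite -mulrA mulr_ge0// -expr2 sqr_ge0.
rewrite inE/= in_itv/= => /andP[t1 t2].
have t0 : 0 < t by lra.
have -> : \1_(`[1%R, +oo[%classic) t = 1 :> R.
  by rewrite indicE mem_set//= in_itv/= t1.
rewrite mul1r radial_weight_gt0//.
rewrite lee_fin -[leLHS]mul1r ler_pM ?(ltW c0) ?exprn_ege1//.
have tV : 2^-1 <= t^-1 by rewrite lef_pV2 ?posrE//; lra.
by rewrite ler_pM ?exprn_ge0// lerXn2r// nnegrE// invr_ge0; lra.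
Qed.

(** On the indicator of the unit ball, the radial integral in polar coordinates
    is at most the total mass of the sphere. *)
Lemma polar_constant_fin_num : k \is a fin_num.
Proof.
rewrite ge0_fin_numE; last exact/ltW/polar_constant_gt0.
have mB := @measurable_eball R d 0 1.
pose chi : rV -> \bar R := EFin \o \1_(eball (0 : rV) 1).
have m1B : measurable_fun setT chi.
  exact/measurable_EFinP/measurable_indic.
have := @polar_coordinates_scaled R d d_gt0 chi m1B.
have B0 v : (0 <= chi v)%E by rewrite lee_fin.
have -> : (\int[lebesgue_rV d]_v chi v = (ball_volume R d)%:E)%E.
  by rewrite /chi integral_indic// setIT; exact: lebesgue_unit_ball.
move=> /(_ B0).
have Nle : (\int[lebesgue_measure]_r ((w r)%:E *
    \int[sphere_measure d]_v chi (r *: v)%R) <=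
    \int[lebesgue_measure]_(r in `[0%R, 1%R]) sphere_measure d [set: rV])%E.
  rewrite [leRHS]integral_mkcond; apply: le_lower_integral => r _.
    by rewrite mule_ge0 ?lee_fin ?radial_weight_ge0//; exact: integral_ge0.
  have mBr : measurable ((fun v : rV => r *: v) @^-1` eball 0 1).
    rewrite -[X in measurable X]setTI.
    by apply: (@measurable_rVZ _ _ _ _ (fun=> r) id) => //; exact: measurable_cst.
  have -> : (\int[sphere_measure d]_v chi (r *: v)%R =
      sphere_measure d ((fun v : rV => r *: v) @^-1` eball 0 1))%E.
    by rewrite -[in RHS](setIT (_ @^-1` _)) -integral_indic.
  have [r0|r0] := ltP 0 (r : R); last first.
    by rewrite radial_weight_le0// mul0e erestrict_ge0.
  have [r1|r1] := ltP (r : R) 1.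
    rewrite patchT; last by rewrite inE/= in_itv/= !ltW.
    rewrite -[leRHS]mul1e; apply: lee_pmul => //.
    - by rewrite lee_fin radial_weight_ge0.
    - by rewrite lee_fin radial_weight_gt0// exprn_ile1// ltW.
    - by apply: le_measure; rewrite ?inE.
  rewrite [X in (_ * X)%E](_ : _ = 0%E) ?mule0 ?erestrict_ge0//.
  apply/eqP; rewrite eq_le measure_ge0 andbT -(@sphere_measure_conull R d).
  apply: le_measure; rewrite ?inE//.
    by apply: measurableC; exact: measurable_unit_sphere.
  move=> v; rewrite /eball /= subr0 enormZ gtr0_norm// => rv v1.
  by move: rv; rewrite v1 mulr1; lra.
move=> NE; move: Nle; rewrite NE integral_cst//= lebesgue_measure_itv/= lte_fin ltr01.
rewrite -EFinB subr0 mule1 => Nle; rewrite ltey; apply/eqP => kE.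
move: Nle; rewrite kE mulry gtr0_sg ?ltr0n// mul1e mulyr gtr0_sg ?ball_volume_gt0// mul1e.
by move=> /le_lt_trans/(_ (@sphere_measure_lty R d)); rewrite ltxx.
Qed.

(** In polar coordinates z = r v, both sides integrate h over pairs of points of
    the sphere of radius r; they differ by the order of integration. *)
Lemma polar_swap (h : rV * rV -> \bar R) :
  measurable_fun setT h -> (forall p, 0 <= h p)%E ->
  (\int[lebesgue_rV d]_z \int[sphere_measure d]_v h (z, enorm z *: v)%R =
   \int[lebesgue_rV d]_z \int[sphere_measure d]_v h (enorm z *: v, z)%R)%E.
Proof.
move=> mh h0.
have m1 : measurable_fun setT (fun p : rV * rV => h (p.1, enorm p.1 *: p.2)).
  apply: (measurableT_comp mh); apply: measurable_fun_pair => //.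
  by apply: measurable_rVZ => //; exact: measurable_fun_enorm.
have m2 : measurable_fun setT (fun p : rV * rV => h (enorm p.1 *: p.2, p.1)).
  apply: (measurableT_comp mh); apply: measurable_fun_pair => //.
  by apply: measurable_rVZ => //; exact: measurable_fun_enorm.
pose psi1 z := (\int[sphere_measure d]_v h (z, enorm z *: v)%R)%E.
pose psi2 z := (\int[sphere_measure d]_v h (enorm z *: v, z)%R)%E.
have mpsi1 : measurable_fun setT psi1.
  exact: (measurable_fun_fubini_tonelli_F (m2 := sphere_measure d)
    (fun p : rV * rV => h (p.1, enorm p.1 *: p.2))).
have mpsi2 : measurable_fun setT psi2.
  exact: (measurable_fun_fubini_tonelli_F (m2 := sphere_measure d)
    (fun p : rV * rV => h (enorm p.1 *: p.2, p.1))).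
have kE : k = (fine k)%:E by rewrite fineK// polar_constant_fin_num.
have c0 : (0 < d%:R * fine k)%R.
  by rewrite mulr_gt0 ?ltr0n// -lte_fin -kE polar_constant_gt0.
have cE : (d%:R%:E * k)%E = (d%:R * fine k)%:E by rewrite kE.
have psi10 z : (0 <= psi1 z)%E by exact: integral_ge0.
have psi20 z : (0 <= psi2 z)%E by exact: integral_ge0.
have := polar_coordinates_scaled d_gt0 mpsi1 psi10.
have := polar_coordinates_scaled d_gt0 mpsi2 psi20.
rewrite cE => E2 E1.
suff E : (\int[lebesgue_measure]_r ((w r)%:E * \int[sphere_measure d]_v psi1 (r *: v)%R) =
    \int[lebesgue_measure]_r ((w r)%:E * \int[sphere_measure d]_v psi2 (r *: v)%R))%E.
  by apply: (mule_pinj c0); rewrite -E1 -E2; exact: E.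
apply: eq_integral => r _; have [r0|r0] := ltP 0 (r : R); last first.
  by rewrite (radial_weight_le0 r0) !mul0e.
suff -> : (\int[sphere_measure d]_v psi1 (r *: v)%R =
           \int[sphere_measure d]_v psi2 (r *: v)%R)%E by [].
pose hr (p : rV * rV) := h (r *: p.1, r *: p.2).
have mhr : measurable_fun setT hr.
  apply: (measurableT_comp mh); apply: measurable_fun_pair.
    by apply: measurable_rVZ.
  by apply: measurable_rVZ.
have hr0 p : (0 <= hr p)%E by exact: h0.
have onS v : enorm v = 1 -> enorm (r *: v) = r.
  by move=> v1; rewrite enormZ v1 mulr1 gtr0_norm.
have mr : measurable_fun setT (fun v : rV => r *: v) by exact: measurable_rVZ.
transitivity (\int[sphere_measure d]_v \int[sphere_measure d]_u hr (v, u))%E.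
  apply: (eq_integral_conull measurable_unit_sphere sphere_measure_conull).
  - by move=> v; exact: psi10.
  - exact: (measurableT_comp mpsi1 mr).
  - by move=> v; apply: integral_ge0 => u _; exact: hr0.
  - exact: (measurable_fun_fubini_tonelli_F (m2 := sphere_measure d) hr mhr hr0).
  by move=> v v1; rewrite /psi1 onS.
transitivity (\int[sphere_measure d]_u \int[sphere_measure d]_v hr (v, u))%E.
  exact: (fubini_tonelli (m1 := sphere_measure d) (m2 := sphere_measure d) hr mhr hr0).
apply: (eq_integral_conull measurable_unit_sphere sphere_measure_conull).
- by move=> v; apply: integral_ge0 => u _; exact: hr0.
- exact: (measurable_fun_fubini_tonelli_G (m1 := sphere_measure d) hr mhr hr0).
- by move=> v; exact: psi20.
- exact: (measurableT_comp mpsi2 mr).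
by move=> v v1; rewrite /psi2 onS.
Qed.

End polar_swap.

(** * Exchange of pre- and post-collisional velocities *)

Section collision_swap.
Context {R : realType} {d : nat}.
Hypothesis d_gt0 : (0 < d)%N.
Local Notation rV := 'rV[R]_d.

(** A reflection and a translation in w, then a translation in v. *)
Lemma integral_center_relative (g : rV * rV -> \bar R) :
  measurable_fun setT g -> (forall p, 0 <= g p)%E ->
  (\int[lebesgue_rV d]_v \int[lebesgue_rV d]_w g (v, w) =
   \int[lebesgue_rV d]_c \int[lebesgue_rV d]_z
     g (c + 2^-1 *: z, c - 2^-1 *: z)%R)%E.
Proof.
move=> mg g0.
have mgz : measurable_fun setT (fun p : rV * rV => g (p.1, p.1 - p.2)).
  apply: (measurableT_comp mg); apply: measurable_fun_pair => //.
  exact: measurable_rVB.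
have mh2 : measurable_fun setT (fun p : rV * rV => 2^-1 *: p.2).
  by apply: measurable_rVZ.
have mgc : measurable_fun setT
    (fun p : rV * rV => g (p.1 + 2^-1 *: p.2, p.1 - 2^-1 *: p.2)).
  apply: (measurableT_comp mg); apply: measurable_fun_pair.
    exact: measurable_rVD.
  exact: measurable_rVB.
transitivity (\int[lebesgue_rV d]_v \int[lebesgue_rV d]_z g (v, v - z)%R)%E.
  apply: eq_integral => v _.
  rewrite -(@integral_lebesgue_rV_affine R d (-1) v (fun w => g (v, w))) ?oppr_eq0//.
    rewrite normrN1 expr1n mul1e; apply: eq_integral => z _.
    by rewrite scaleN1r addrC.
  exact: (measurableT_comp mg (pair1_measurable v)).
transitivity (\int[lebesgue_rV d]_z \int[lebesgue_rV d]_v g (v, v - z)%R)%E.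
  exact: (fubini_tonelli (fun p : rV * rV => g (p.1, p.1 - p.2)) mgz (fun=> g0 _)).
transitivity (\int[lebesgue_rV d]_z \int[lebesgue_rV d]_c
    g (c + 2^-1 *: z, c - 2^-1 *: z)%R)%E; last first.
  exact: (esym (fubini_tonelli
    (fun p : rV * rV => g (p.1 + 2^-1 *: p.2, p.1 - 2^-1 *: p.2)) mgc (fun=> g0 _))).
apply: eq_integral => z _.
rewrite -(@integral_lebesgue_rV_affine R d 1 (2^-1 *: z) (fun v => g (v, v - z)))//.
  rewrite normr1 expr1n mul1e; apply: eq_integral => c _.
  rewrite scale1r; congr (g (_, _)); rewrite -addrA; congr (_ + _).
  by rewrite -{2}(scale1r z) -scalerBl -scaleNr; congr (_ *: _); lra.
exact: (measurableT_comp mgz (pair2_measurable z)).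
Qed.

Let half_sum (c z : rV) :
  2^-1 *: ((c + 2^-1 *: z) + (c - 2^-1 *: z)) = c.
Proof. by apply/rowP => i; rewrite !mxE; field. Qed.

Let half_difference (c z : rV) : (c - 2^-1 *: z) - (c + 2^-1 *: z) = - z.
Proof. by apply/rowP => i; rewrite !mxE; field. Qed.

Lemma post_v_center_relative (c z v : rV) :
  post_v (c + 2^-1 *: z) (c - 2^-1 *: z) v = c + 2^-1 *: (enorm z *: v).
Proof. by rewrite /post_v half_sum half_difference enormN scalerA (mulrC 2^-1). Qed.

Lemma post_w_center_relative (c z v : rV) :
  post_w (c + 2^-1 *: z) (c - 2^-1 *: z) v = c - 2^-1 *: (enorm z *: v).
Proof. by rewrite /post_w half_sum half_difference enormN scalerA (mulrC 2^-1). Qed.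

Lemma measurable_post_v : measurable_fun setT
  (fun p : (rV * rV) * rV => post_v p.1.1 p.1.2 p.2).
Proof.
have m11 : measurable_fun setT (fun p : (rV * rV) * rV => p.1.1).
  exact: (measurableT_comp measurable_fst measurable_fst).
have m12 : measurable_fun setT (fun p : (rV * rV) * rV => p.1.2).
  exact: (measurableT_comp measurable_snd measurable_fst).
apply: measurable_rVD.
  by apply: measurable_rVZ => //; exact: measurable_rVD.
apply: measurable_rVZ => //; apply: measurable_funM => //.
by apply: measurable_fun_enorm; exact: measurable_rVB.
Qed.

Lemma measurable_post_w : measurable_fun setT
  (fun p : (rV * rV) * rV => post_w p.1.1 p.1.2 p.2).
Proof.
have m11 : measurable_fun setT (fun p : (rV * rV) * rV => p.1.1).
  exact: (measurableT_comp measurable_fst measurable_fst).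
have m12 : measurable_fun setT (fun p : (rV * rV) * rV => p.1.2).
  exact: (measurableT_comp measurable_snd measurable_fst).
apply: measurable_rVB.
  by apply: measurable_rVZ => //; exact: measurable_rVD.
apply: measurable_rVZ => //; apply: measurable_funM => //.
by apply: measurable_fun_enorm; exact: measurable_rVB.
Qed.

(** At a fixed centre of mass, a collision replaces the relative velocity z by
    |z| u, and these two are exchanged by [polar_swap]. *)
Lemma integral_pre_post_swap (H : (rV * rV) * (rV * rV) -> \bar R) :
  measurable_fun setT H -> (forall p, 0 <= H p)%E ->
  (\int[lebesgue_rV d]_v \int[lebesgue_rV d]_w \int[sphere_measure d]_u
     H ((v, w), (post_v v w u, post_w v w u)) =
   \int[lebesgue_rV d]_v \int[lebesgue_rV d]_w \int[sphere_measure d]_u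
     H ((post_v v w u, post_w v w u), (v, w)))%E.
Proof.
move=> mH H0.
have mpost : measurable_fun setT
    (fun p : (rV * rV) * rV => (post_v p.1.1 p.1.2 p.2, post_w p.1.1 p.1.2 p.2)).
  by apply: measurable_fun_pair; [exact: measurable_post_v|exact: measurable_post_w].
have mH1 : measurable_fun setT (fun p : (rV * rV) * rV =>
    H (p.1, (post_v p.1.1 p.1.2 p.2, post_w p.1.1 p.1.2 p.2))).
  by apply: (measurableT_comp mH); exact: measurable_fun_pair.
have mH2 : measurable_fun setT (fun p : (rV * rV) * rV =>
    H ((post_v p.1.1 p.1.2 p.2, post_w p.1.1 p.1.2 p.2), p.1)).
  by apply: (measurableT_comp mH); exact: measurable_fun_pair.
rewrite (integral_center_relative (g := fun p : rV * rV => \int[sphere_measure d]_u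
     H (p, (post_v p.1 p.2 u, post_w p.1 p.2 u)))%E); last 2 first.
- exact: (measurable_fun_fubini_tonelli_F (m2 := sphere_measure d) _ mH1).
- by move=> p; apply: integral_ge0 => u _; exact: H0.
rewrite (integral_center_relative (g := fun p : rV * rV => \int[sphere_measure d]_u
     H ((post_v p.1 p.2 u, post_w p.1 p.2 u), p))%E); last 2 first.
- exact: (measurable_fun_fubini_tonelli_F (m2 := sphere_measure d) _ mH2).
- by move=> p; apply: integral_ge0 => u _; exact: H0.
apply: eq_integral => c _ /=.
pose h (p : rV * rV) := H ((c + 2^-1 *: p.1, c - 2^-1 *: p.1),
                           (c + 2^-1 *: p.2, c - 2^-1 *: p.2)).
have mh : measurable_fun setT h.
  have mc (q : rV * rV -> rV) : measurable_fun setT q ->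
      measurable_fun setT (fun p => (c + 2^-1 *: q p, c - 2^-1 *: q p)).
    move=> mq; have m2q : measurable_fun setT (fun p => 2^-1 *: q p) by exact: measurable_rVZ.
    by apply: measurable_fun_pair; [exact: measurable_rVD|exact: measurable_rVB].
  by apply: (measurableT_comp mH); apply: measurable_fun_pair; exact: mc.
have := polar_swap d_gt0 mh (fun p => H0 _).
rewrite /h /=; under eq_integral do under eq_integral
  do rewrite -post_v_center_relative -post_w_center_relative.
move=> ->; under eq_integral do under eq_integral
  do rewrite -post_v_center_relative -post_w_center_relative.
by [].
Qed.

End collision_swap.

(** * Pointwise lower bounds for the kernel and the entropy production *)

Section angular_lower_bound.
Context {R : realType}.

Lemma sin_mean_value (x : R) : 0 <= x ->
  exists2 c, 0 <= c <= x & sin x = cos c * x.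
Proof.
move=> x0; have [] := @MVT_segment R sin cos 0 x x0.
- by apply: continuous_subspaceT; exact: continuous_sin.
- by move=> c; rewrite in_itv/= sin0 !subr0 => cx ->; exists c.
Qed.

Lemma sin_le_id (x : R) : 0 <= x -> sin x <= x.
Proof.
move=> x0; have [c _ ->] := sin_mean_value x0.
by rewrite -[leRHS]mul1r ler_wpM2r// cos_le1.
Qed.

(** For a unit vector at Euclidean distance a from a direction, the deviation
    angle has cosine 1 - a^2 / 2. *)
Lemma chord_angle (a : R) : 0 < a <= 1 ->
  exists theta, [/\ 0 < theta <= pi / 2, cos theta = 1 - a ^+ 2 / 2 &
    theta <= 2 * a].
Proof.
move=> /andP[a0 a1]; pose c := 1 - a ^+ 2 / 2.
have a2 : a ^+ 2 <= 1 by rewrite expr_le1// ltW.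
have a20 : 0 < a ^+ 2 by rewrite exprn_gt0.
have c1 : -1 <= c < 1 by rewrite /c; apply/andP; split; lra.
have cin : c \in `[(-1), 1] by rewrite in_itv/=; lra.
have t0 : 0 < acos c by exact: acos_gt0.
have tpi : acos c <= pi by apply: acos_lepi; lra.
have ct : cos (acos c) = c by rewrite acosK.
have pi0 := @pi_gt0 R.
have th : acos c <= pi / 2.
  rewrite leNgt; apply/negP => tg.
  have : cos (acos c) < cos (pi / 2) by rewrite ltr_cos ?in_itv/=; lra.
  by rewrite cos_pihalf ct /c; lra.
exists (acos c); split => //; first by rewrite t0.
have [y /andP[y0 yt] E] := @sin_mean_value (acos c / 2) ltac:(lra).
have cy : 1 / 2 <= cos y.
  have : cos (acos c) <= cos y.
    rewrite leNgt; apply/negP; rewrite ltr_cos ?in_itv/= => [K||]; lra.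
  by rewrite ct /c; lra.
have : 1 - a ^+ 2 / 2 = 1 - 2 * sin (acos c / 2) ^+ 2.
  rewrite -/c -{1}ct {1}(_ : acos c = (acos c / 2) *+ 2); last by rewrite -mulr_natr divfK.
  by rewrite cos_mulr2n cos2sin2 -mulr_natl; ring.
rewrite E => H; set t := acos c in t0 y0 yt E H *.
have : (t / 4) ^+ 2 <= (cos y * (t / 2)) ^+ 2.
  by rewrite lerXn2r ?nnegrE//; nra.
move=> K; rewrite -(@ler_pXn2r _ 2) ?nnegrE ?mulr_ge0 ?(ltW t0) ?(ltW a0)//.
have t16 : (t / 4) ^+ 2 = t ^+ 2 / 16 by field.
by rewrite exprMn; lra.
Qed.

(** As sin theta <= theta, the bound on (sin theta)^(d-2) b forces b to be at
    least of order theta^(-(d-1)-2s), and the angle is at most twice the chord. *)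
Lemma angular_kernel_ge d (s : R) (b : R -> R) : (2 <= d)%N -> 0 < s ->
  angular_kernel d s b ->
  exists2 c, 0 < c & forall a alpha, 0 < a <= alpha -> alpha <= 1 ->
    c * alpha `^ (- (d.-1%:R + 2 * s)) <= b (1 - a ^+ 2 / 2).
Proof.
move=> d2 s0 [_ _ [cb cb0 bP]]; pose k := d.-1%:R + 2 * s.
exists (cb^-1 * 2 `^ (- k)); first by rewrite mulr_gt0 ?invr_gt0// powR_gt0.
move=> a alpha /andP[a0 aal] al1.
have [|t [/andP[t0 tpi] <- ta]] := @chord_angle a; first by rewrite a0 (le_trans aal).
have := bP t; rewrite t0 tpi => /(_ isT)/andP[+ _].
have st0 : 0 < sin t by apply: sin_gt0_pi; have := @pi_gt0 R; lra.
rewrite [leRHS]mulrC -ler_pdivrMr ?exprn_gt0// => H; apply: le_trans H.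
rewrite -mulrA -powRM// ?(le_trans (ltW a0))//.
rewrite -mulrA ler_wpM2l ?invr_ge0 ?(ltW cb0)//.
apply: (@le_trans _ _ (t `^ (- k))).
  rewrite !powRN lef_pV2 ?posrE ?powR_gt0//; last by lra.
  rewrite ge0_ler_powR ?nnegrE//; [|exact: ltW| |].
  - by rewrite addr_ge0// mulr_ge0// ltW.
  - by lra.
  - by lra.
rewrite ler_pdivlMr ?exprn_gt0//.
apply: (@le_trans _ _ (t `^ (- k) * t ^+ (d - 2))).
  by rewrite ler_wpM2l ?powR_ge0// lerXn2r ?nnegrE ?(ltW st0) ?(ltW t0)//; exact: sin_le_id (ltW t0).
rewrite -powR_mulrn ?(ltW t0)// -powRD; last by apply/implyP => _; rewrite gt_eqF.
rewrite le_eqVlt; apply/orP; left; apply/eqP; congr (t `^ _); rewrite /k.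
rewrite (_ : d.-1%:R = (d - 2)%:R + 1 :> R); first by ring.
by rewrite natr1 -subSn// subSS subn1.
Qed.

End angular_lower_bound.

Section entropy_gap.
Context {R : realType}.

Lemma entropy_gap_ge0 (x y : R) : 0 <= x -> 0 <= y -> (0 <= entropy_gap x y)%E.
Proof.
move=> x0 y0; rewrite /entropy_gap; case: ifPn => [//|]; case: ifPn => [//|].
rewrite negb_or => /andP[xn yn] _; rewrite lee_fin.
have {xn}x0 : 0 < x by rewrite lt_neqAle eq_sym xn.
have {yn}y0 : 0 < y by rewrite lt_neqAle eq_sym yn.
rewrite ln_div ?posrE//; have [xy|xy] := leP x y.
  have : ln x <= ln y by rewrite ler_ln ?posrE.
  by nra.
have : ln y <= ln x by rewrite ler_ln ?posrE// ltW.
by nra.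
Qed.

(** ln t >= 1 - 1 / t bounds the gap below by (x - y)^2 / x >= x - 2 y. *)
Lemma entropy_gap_ge (x y : R) : 0 <= x -> 0 <= y ->
  ((Num.max (x - 2 * y) 0)%:E <= entropy_gap x y)%E.
Proof.
move=> x0 y0; have [xy|xy] := leP (x - 2 * y) 0.
  by rewrite entropy_gap_ge0.
rewrite /entropy_gap; case: ifPn => [/andP[/eqP ? /eqP ?]|]; first by exfalso; lra.
case: ifPn => [_ _|]; first by rewrite leey.
rewrite negb_or => /andP[xn yn] _; rewrite lee_fin.
have {xn}x0 : 0 < x by rewrite lt_neqAle eq_sym xn.
have {yn}y0 : 0 < y by rewrite lt_neqAle eq_sym yn.
have : ln (1 + (y / x - 1)) <= y / x - 1.
  by apply: le_ln1Dx; rewrite ltrBrDr addNr divr_gt0.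
rewrite addrC subrK => H.
have -> : ln (x / y) = - ln (y / x) by rewrite !ln_div ?posrE// opprB.
apply: (@le_trans _ _ ((x - y) * (1 - y / x))); last by rewrite ler_wpM2l; lra.
have -> : (x - y) * (1 - y / x) = x - 2 * y + y * (y / x) by field; rewrite gt_eqF.
by rewrite lerDl mulr_ge0 ?divr_ge0// ltW.
Qed.

Lemma max_sub2xx (x : R) : 0 <= x -> Num.max (x - 2 * x) 0 = 0.
Proof. by move=> x0; apply/max_idPr; lra. Qed.

End entropy_gap.

(** * Grazing collisions with the bulk *)

Section collision_region.
Context {R : realType} {d : nat}.
Local Notation rV := 'rV[R]_d.
Implicit Types (v w u : rV).
Variables (w0 : rV) (eps delta rho alpha : R).

(** Partners far enough from the concentration point w0 for the relative
    velocity to stay away from 0, and bounded. *)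
Definition bulk : set rV := [set w | delta <= enorm (w - w0) /\ enorm w <= rho].

(** The last component is the outgoing velocity v'; as |v' - v| is |v - w| / 2
    times the chord between the collision parameter and the direction of v - w,
    the third condition bounds this chord by alpha, in a form that is symmetric
    in incoming and outgoing velocities. *)
Definition grazing_region : set ((rV * rV) * rV) :=
  [set p | [/\ eball w0 eps p.1.1, bulk p.1.2 &
    enorm (p.2 - p.1.1) <= alpha / 2 * enorm (p.1.1 - p.1.2)]].

Lemma measurable_bulk : measurable bulk.
Proof.
rewrite (_ : bulk = ((fun w => enorm (w - w0)) @^-1` `[delta, +oo[) `&`
                    (enorm @^-1` `]-oo, rho])); last first.
  by apply/seteqP; split => w /=; rewrite !in_itv/= ?andbT.
apply: measurableI; rewrite -[X in measurable X]setTI.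
  by apply: measurable_fun_enorm => //; exact: measurable_rVB.
exact: measurable_enorm.
Qed.

Lemma measurable_grazing_region : measurable grazing_region.
Proof.
have m11 : measurable_fun setT (fun p : (rV * rV) * rV => p.1.1).
  exact: (measurableT_comp measurable_fst measurable_fst).
have m12 : measurable_fun setT (fun p : (rV * rV) * rV => p.1.2).
  exact: (measurableT_comp measurable_snd measurable_fst).
rewrite (_ : grazing_region =
  ((fun p => p.1.1) @^-1` eball w0 eps) `&` ((fun p => p.1.2) @^-1` bulk) `&`
  ((fun p => alpha / 2 * enorm (p.1.1 - p.1.2) - enorm (p.2 - p.1.1)) @^-1`
    `[0, +oo[)); last first.
  apply/seteqP; split => p /=; rewrite in_itv/= andbT subr_ge0.
    by move=> [].
  by move=> [[]].
apply: measurableI; first apply: measurableI; rewrite -[X in measurable X]setTI.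
- by apply: m11 => //; exact: measurable_eball.
- by apply: m12 => //; exact: measurable_bulk.
apply: measurable_funB => //; last first.
  by apply: measurable_fun_enorm; exact: measurable_rVB.
apply: measurable_funM => //.
by apply: measurable_fun_enorm; exact: measurable_rVB.
Qed.

End collision_region.

Section collision_geometry.
Context {R : realType} {d : nat}.
Local Notation rV := 'rV[R]_d.
Implicit Types (v w u : rV).

Lemma post_vBv v w u :
  post_v v w u - v = (enorm (v - w) / 2) *: (u - direction (v - w)).
Proof.
rewrite scalerBr (mulrC _ 2^-1) -(scalerA _ _ (direction _)) direction_enorm.
rewrite /post_v enormBC mulrC; set k := _ *: u.
by apply/rowP => i; rewrite !mxE; field.
Qed.

Lemma post_vBw v w u : post_v v w u - post_w v w u = enorm (v - w) *: u.
Proof.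
by rewrite /post_v /post_w enormBC; apply/rowP => i; rewrite !mxE; field.
Qed.

Lemma post_direction v w :
  post_v v w (direction (v - w)) = v /\ post_w v w (direction (v - w)) = w.
Proof.
have E : (enorm (w - v) / 2) *: direction (v - w) = 2^-1 *: (v - w).
  by rewrite enormBC mulrC -scalerA direction_enorm.
by rewrite /post_v /post_w E; split; apply/rowP => i; rewrite !mxE; field.
Qed.

Lemma cos_deviation_chord v w u : v != w -> enorm u = 1 ->
  cos_deviation v w u = 1 - enorm (u - direction (v - w)) ^+ 2 / 2.
Proof.
move=> vw u1; rewrite enorm_subr_sqr u1 enorm_direction ?subr_eq0//.
by rewrite /cos_deviation; field.
Qed.

Lemma cos_deviation_itv v w u : enorm u = 1 -> -1 <= cos_deviation v w u <= 1.
Proof.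
move=> u1; have [->|vw] := eqVneq v w.
  by rewrite /cos_deviation subrr /direction scaler0 -(scale0r 0) dotvZr mul0r; lra.
have e1 : enorm (direction (v - w)) = 1 by rewrite enorm_direction// subr_eq0.
have := dotv_le_enorm u (direction (v - w)).
have := dotv_le_enorm (- u) (direction (v - w)).
by rewrite dotvNl enormN u1 e1 mulr1 -/(cos_deviation v w u) => *; lra.
Qed.

End collision_geometry.

Lemma indicator_ge0 (R : numDomainType) (T : Type) (A : set T) (x : T) :
  0 <= \1_A x :> R.
Proof. by rewrite indicE. Qed.

Section collision_integral.
Context {R : realType} {d : nat}.
Local Notation rV := 'rV[R]_d.
Local Notation mu := (lebesgue_rV d).
Local Notation sph := (sphere_measure d).
Implicit Types g h : (rV * rV) * rV -> \bar R.

Definition collision_integral g : \bar R :=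
  (\int[mu]_v \int[mu]_w \int[sph]_u g ((v, w), u))%E.

Lemma measurable_integral_sphere g : measurable_fun setT g -> (forall p, 0 <= g p)%E ->
  measurable_fun setT (fun p : rV * rV => \int[sph]_u g (p, u))%E.
Proof. by move=> mg g0; exact: (measurable_fun_fubini_tonelli_F (m2 := sph) g). Qed.

Lemma measurable_integral_partner g : measurable_fun setT g -> (forall p, 0 <= g p)%E ->
  measurable_fun setT (fun v : rV => \int[mu]_w \int[sph]_u g ((v, w), u))%E.
Proof.
move=> mg g0; apply: (measurable_fun_fubini_tonelli_F
  (fun p : rV * rV => \int[sph]_u g (p, u))%E); first exact: measurable_integral_sphere.
by move=> p; exact: integral_ge0.
Qed.

Lemma collision_integralD g h : measurable_fun setT g -> (forall p, 0 <= g p)%E ->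
  measurable_fun setT h -> (forall p, 0 <= h p)%E ->
  collision_integral (fun p => g p + h p)%E = (collision_integral g + collision_integral h)%E.
Proof.
move=> mg g0 mh h0; rewrite /collision_integral -ge0_integralD//; first last.
- exact: measurable_integral_partner.
- by move=> v _; apply: integral_ge0 => w _; exact: integral_ge0.
- exact: measurable_integral_partner.
- by move=> v _; apply: integral_ge0 => w _; exact: integral_ge0.
apply: eq_integral => v _; rewrite -ge0_integralD//; first last.
- exact: (measurableT_comp (measurable_integral_sphere mh h0) (pair1_measurable _)).
- by move=> w _; exact: integral_ge0.
- exact: (measurableT_comp (measurable_integral_sphere mg g0) (pair1_measurable _)).
- by move=> w _; exact: integral_ge0.
apply: eq_integral => w _; rewrite -ge0_integralD//.
- exact: (measurableT_comp mg (pair1_measurable _)).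
- exact: (measurableT_comp mh (pair1_measurable _)).
Qed.

End collision_integral.

Section grazing_estimate.
Context {R : realType} {d : nat}.
Hypothesis d_gt0 : (0 < d)%N.
Local Notation rV := 'rV[R]_d.
Local Notation mu := (lebesgue_rV d).
Local Notation sph := (sphere_measure d).
Variables (w0 : rV) (eps delta rho alpha c : R).
Hypotheses (eps_gt0 : 0 < eps)
  (w0_rho : enorm w0 + eps <= rho) (alpha01 : 0 < alpha < 1)
  (eps_small : 4 * eps < delta) (c_gt0 : 0 < c).
Variable f : rV -> R.
Hypotheses (mf : measurable_fun setT f) (f_ge0 : forall v, 0 <= f v).

Local Notation U := (bulk w0 delta rho).
Local Notation A := (eball w0 eps).
Local Notation A' := (eball w0 (eps + alpha * rho)).
Local Notation Rg := (grazing_region w0 eps delta rho alpha).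

Let chi v w v' : R := \1_Rg ((v, w), v').

Let mf_fst2 d1 (T : measurableType d1) (q : T -> rV) :
  measurable_fun setT q -> measurable_fun setT (fun x => f (q x)).
Proof. by move=> mq; exact: measurableT_comp. Qed.

Let mchi d1 (T : measurableType d1) (q1 q2 q3 : T -> rV) :
  measurable_fun setT q1 -> measurable_fun setT q2 -> measurable_fun setT q3 ->
  measurable_fun setT (fun x => chi (q1 x) (q2 x) (q3 x)).
Proof.
move=> m1 m2 m3; have mi : measurable_fun setT (\1_Rg : (rV * rV) * rV -> R).
  by apply: measurable_indic; exact: measurable_grazing_region.
apply: (measurableT_comp mi); apply: measurable_fun_pair => //.
exact: measurable_fun_pair.
Qed.

Lemma grazing_indicator v w v' : (chi v w v' = 1 /\ Rg ((v, w), v')) \/ chi v w v' = 0.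
Proof.
rewrite /chi indicE; case E : (_ \in _); last by right.
by left; split => //; exact: set_mem E.
Qed.

Let chi_ge0 v w v' : 0 <= chi v w v'. Proof. by []. Qed.

Definition mass (S : set rV) : \bar R := (\int[mu]_v (\1_S v * f v)%:E)%E.

Let mloc S : measurable S -> measurable_fun setT (fun v => (\1_S v * f v)%:E : \bar R).
Proof.
by move=> mS; apply/measurable_EFinP; apply: measurable_funM.
Qed.

Let loc_ge0 S v : (0 <= (\1_S v * f v)%:E :> \bar R)%E.
Proof. by rewrite lee_fin mulr_ge0. Qed.

Lemma mass_ge0 S : (0 <= mass S)%E. Proof. exact: integral_ge0. Qed.

(* The products f f_* before the collision and f' f'_* after it, and the positive
   part that controls their difference, integrated over grazing collisions. *)
Let forward : \bar R := (\int[mu]_v \int[mu]_w \int[sph]_u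
  (c * chi v w (post_v v w u) * (f v * f w))%:E)%E.
Let backward : \bar R := (\int[mu]_v \int[mu]_w \int[sph]_u
  (c * chi v w (post_v v w u) * (f (post_v v w u) * f (post_w v w u)))%:E)%E.
Let excess : \bar R := (\int[mu]_v \int[mu]_w \int[sph]_u
  (c * chi v w (post_v v w u) *
   Num.max (f v * f w - 2 * (f (post_v v w u) * f (post_w v w u))) 0)%:E)%E.

Let p11 : measurable_fun setT (fun p : (rV * rV) * rV => p.1.1).
Proof. exact: (measurableT_comp measurable_fst measurable_fst). Qed.
Let p12 : measurable_fun setT (fun p : (rV * rV) * rV => p.1.2).
Proof. exact: (measurableT_comp measurable_snd measurable_fst). Qed.
Let pv := @measurable_post_v R d.
Let pw := @measurable_post_w R d.

Let mcchi : measurable_fun setT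
  (fun p : (rV * rV) * rV => c * chi p.1.1 p.1.2 (post_v p.1.1 p.1.2 p.2)).
Proof. by apply: measurable_funM => //; exact: mchi. Qed.

Let mff : measurable_fun setT (fun p : (rV * rV) * rV => f p.1.1 * f p.1.2).
Proof. by apply: measurable_funM; exact: mf_fst2. Qed.

Let mffp : measurable_fun setT (fun p : (rV * rV) * rV =>
  f (post_v p.1.1 p.1.2 p.2) * f (post_w p.1.1 p.1.2 p.2)).
Proof. by apply: measurable_funM; exact: mf_fst2. Qed.

Let g1 (p : (rV * rV) * rV) : \bar R :=
  (c * chi p.1.1 p.1.2 (post_v p.1.1 p.1.2 p.2) * (f p.1.1 * f p.1.2))%:E.
Let g2 (p : (rV * rV) * rV) : \bar R :=
  (c * chi p.1.1 p.1.2 (post_v p.1.1 p.1.2 p.2) *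
   (f (post_v p.1.1 p.1.2 p.2) * f (post_w p.1.1 p.1.2 p.2)))%:E.
Let g3 (p : (rV * rV) * rV) : \bar R :=
  (c * chi p.1.1 p.1.2 (post_v p.1.1 p.1.2 p.2) *
   Num.max (f p.1.1 * f p.1.2 -
    2 * (f (post_v p.1.1 p.1.2 p.2) * f (post_w p.1.1 p.1.2 p.2))) 0)%:E.

Let mg1 : measurable_fun setT g1.
Proof. by apply/measurable_EFinP; apply: measurable_funM. Qed.
Let mg2 : measurable_fun setT g2.
Proof. by apply/measurable_EFinP; apply: measurable_funM. Qed.
Let mg3 : measurable_fun setT g3.
Proof.
apply/measurable_EFinP; apply: measurable_funM => //.
apply: measurable_maxr => //; apply: measurable_funB => //.
exact: measurable_funM.
Qed.

Let g1_ge0 p : (0 <= g1 p)%E.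
Proof. by rewrite lee_fin !mulr_ge0// ltW. Qed.
Let g2_ge0 p : (0 <= g2 p)%E.
Proof. by rewrite lee_fin !mulr_ge0// ltW. Qed.
Let g3_ge0 p : (0 <= g3 p)%E.
Proof. by rewrite lee_fin !mulr_ge0 ?(ltW c_gt0)// le_max lexx orbT. Qed.

(* x <= (x - 2 y)^+ + 2 y *)
Let forward_le : (forward <= excess + (backward + backward))%E.
Proof.
rewrite -[leRHS](_ : collision_integral (fun p => g3 p + (g2 p + g2 p))%E = _); last first.
  rewrite collision_integralD// ?collision_integralD//.
  - exact: emeasurable_funD.
  - by move=> p; rewrite adde_ge0.
apply: le_lower_integral => v _.
  by apply: integral_ge0 => w _; apply: integral_ge0 => u _; exact: (g1_ge0 ((v, w), u)).
apply: le_lower_integral => w _.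
  by apply: integral_ge0 => u _; exact: (g1_ge0 ((v, w), u)).
apply: le_lower_integral => u _; first exact: (g1_ge0 ((v, w), u)).
rewrite /g2 /g3 /= -!EFinD lee_fin.
set x := f v * f w; set y := f _ * f _; set k := c * _.
have k0 : 0 <= k by rewrite mulr_ge0// ltW.
have : x - 2 * y <= Num.max (x - 2 * y) 0 by rewrite le_max lexx.
by nra.
Qed.


Let bulk_distance (v w : rV) : A v -> U w -> delta / 2 <= enorm (v - w).
Proof.
rewrite /eball /= => vA [wU _]; have := ler_enorm_dist v w w0.
by rewrite (enormBC w v) => ?; have := eps_small; have := eps_gt0; lra.
Qed.

Let bulk_distance_le (v w : rV) : A v -> U w -> enorm (v - w) <= 2 * rho.
Proof.
rewrite /eball /= => vA [_ wU]; have := ler_enorm_dist w0 v 0.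
by have := ler_enormD v (- w); rewrite enormN !subr0 => *; have := w0_rho; lra.
Qed.

Let delta_gt0 : 0 < delta. Proof. by move: eps_gt0 eps_small => *; lra. Qed.

Let neq_of_distance (v w : rV) : delta / 2 <= enorm (v - w) -> v != w.
Proof.
move=> vw; rewrite -subr_eq0 -enorm_gt0; apply: lt_le_trans vw.
by rewrite divr_gt0.
Qed.

(* If the chord vanishes then the collision is trivial and the excess is 0;
   otherwise the kernel is at least c. *)
Let excess_le_dissipation (cPhi gamma bmin : R) (b : R -> R) :
  0 < cPhi -> gamma <= 0 -> (forall x, -1 <= x <= 1 -> 0 <= b x) ->
  0 <= bmin -> (forall a, 0 < a <= alpha -> bmin <= b (1 - a ^+ 2 / 2)) ->
  c = cPhi * (2 * rho) `^ gamma * bmin ->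
  (excess <= 4%:E * entropy_dissipation cPhi gamma b f)%E.
Proof.
move=> cPhi0 gam0 b0 bmin0 bb cE.
rewrite /entropy_dissipation muleA -EFinM divff// mul1e.
apply: le_lower_integral => v _.
  by apply: integral_ge0 => w _; apply: integral_ge0 => u _; exact: (g3_ge0 ((v, w), u)).
apply: le_lower_integral => w _.
  by apply: integral_ge0 => u _; exact: (g3_ge0 ((v, w), u)).
apply: (le_lower_integral_conull measurable_unit_sphere sphere_measure_conull).
- by move=> u; exact: (g3_ge0 ((v, w), u)).
- have mg3vw : measurable_fun setT (fun u : rV => g3 ((v, w), u)).
    exact: (measurableT_comp mg3 (pair1_measurable (v, w))).
  exact: mg3vw.
move=> u /= u1.
have ker0 : 0 <= collision_kernel cPhi gamma b v w u.
  rewrite mulr_ge0// ?b0 ?cos_deviation_itv// mulr_ge0 ?powR_ge0//; exact: ltW.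
have x0 : 0 <= f v * f w by rewrite mulr_ge0.
have y0 : 0 <= f (post_v v w u) * f (post_w v w u) by rewrite mulr_ge0.
have [RgP|RgN] := boolP (((v, w), post_v v w u) \in Rg); last first.
  rewrite /chi indicE (negbTE RgN) mulr0 mul0r mule_ge0 ?lee_fin//.
  exact: entropy_gap_ge0.
rewrite /chi indicE RgP mulr1.
move: RgP; rewrite inE => -[/= vA wU]; rewrite post_vBv enormZ => near_v.
have dvw := bulk_distance vA wU; have vw := neq_of_distance dvw.
have z0 : 0 < enorm (v - w) by apply: lt_le_trans dvw; rewrite divr_gt0.
have [ue|une] := eqVneq u (direction (v - w)).
  move: ker0 y0; rewrite ue; have [-> ->] := post_direction v w => ker0 y0.
  rewrite max_sub2xx// mulr0.
  by rewrite mule_ge0 ?lee_fin//; exact: entropy_gap_ge0.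
apply: (@le_trans _ _ (entropy_gap (f v * f w)
    (f (post_v v w u) * f (post_w v w u)) * c%:E)%E).
  rewrite muleC EFinM; apply: lee_wpmul2l; first by rewrite lee_fin ltW.
  exact: entropy_gap_ge.
apply: lee_wpmul2l; first exact: entropy_gap_ge0.
rewrite lee_fin cE /collision_kernel ler_pM ?mulr_ge0 ?powR_ge0 ?(ltW cPhi0)//.
  rewrite ler_wpM2l ?(ltW cPhi0)// -[gamma]opprK !(powRN _ (- gamma)).
  have zrho := bulk_distance_le vA wU; have rho2 : 0 < 2 * rho by exact: lt_le_trans zrho.
  rewrite lef_pV2 ?posrE ?powR_gt0//.
  by rewrite ge0_ler_powR ?nnegrE ?oppr_ge0 ?(ltW z0) ?(ltW rho2).
rewrite cos_deviation_chord//; apply: bb.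
rewrite enorm_gt0 subr_eq0 une/=; move: near_v.
rewrite gtr0_norm ?divr_gt0// mulrAC [leRHS]mulrAC ler_pM2r ?invr_gt0//.
by rewrite mulrC ler_pM2r.
Qed.

Lemma mcap (v w : rV) : measurable
  [set u : rV | enorm (post_v v w u - v) <= alpha / 2 * enorm (v - w)].
Proof.
rewrite (_ : [set _ | _] = (fun u => enorm (post_v v w u - v)) @^-1`
    `]-oo, alpha / 2 * enorm (v - w)]); last first.
  by apply/seteqP; split => u /=; rewrite in_itv.
rewrite -[X in measurable X]setTI; apply: measurable_fun_enorm => //.
apply: measurable_rVB => //.
exact: (measurableT_comp pv (pair1_measurable (v, w))).
Qed.

Let kl := 4 ^- d * ball_volume R d * alpha ^+ d.-1.

Let kl_ge0 : 0 <= kl.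
Proof.
have /andP[/ltW a0 _] := alpha01; rewrite mulr_ge0 ?exprn_ge0//.
apply: mulr_ge0; last exact: ltW ball_volume_gt0.
by rewrite invr_ge0 exprn_ge0.
Qed.

Let loc_product_ge0 (k : R) (S1 S2 : set rV) v w : 0 <= k ->
  0 <= k * (\1_S1 v * f v) * (\1_S2 w * f w).
Proof. by move=> k0; rewrite mulr_ge0 ?mulr_ge0// mulr_ge0. Qed.

Let ckl_ge0 : 0 <= c * kl.
Proof. by apply: mulr_ge0 => //; exact: ltW. Qed.

Let integral_product (k : R) (S1 S2 : set rV) : 0 <= k -> measurable S1 -> measurable S2 ->
  (\int[mu]_v \int[mu]_w (k * (\1_S1 v * f v) * (\1_S2 w * f w))%:E =
   k%:E * (mass S1 * mass S2))%E.
Proof.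
move=> k0 m1 m2; rewrite /mass.
have kS1 : (k%:E * \int[mu]_v (\1_S1 v * f v)%:E =
    \int[mu]_v (k * (\1_S1 v * f v))%:E)%E.
  by rewrite -ge0_integralZl//; exact: mloc.
rewrite muleA kS1 -ge0_integralZr//; first last.
all: try exact: mass_ge0.
all: try by move=> v _; rewrite lee_fin !mulr_ge0.
all: try by apply/measurable_EFinP; apply: measurable_funM => //; exact: measurable_funM.
apply: eq_integral => v _; rewrite -ge0_integralZl//.
all: try exact: mloc.
all: try by rewrite lee_fin !mulr_ge0.
Qed.

(* The collision parameters fill a cap of radius alpha. *)
Let le_forward : ((c * kl)%:E * (mass A * mass U) <= forward)%E.
Proof.
rewrite -integral_product//; last 2 first.
- exact: measurable_eball.
- exact: measurable_bulk.
apply: le_lower_integral => v _.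
  by apply: integral_ge0 => w _; rewrite lee_fin loc_product_ge0.
apply: le_lower_integral => w _; first by rewrite lee_fin loc_product_ge0.
have [vA|vA] := boolP (v \in A); last first.
  have -> : \1_A v = 0 :> R by rewrite indicE (negbTE vA).
  rewrite mul0r mulr0 mul0r.
  by apply: integral_ge0 => u _; exact: (g1_ge0 ((v, w), u)).
have [wU|wU] := boolP (w \in U); last first.
  have -> : \1_U w = 0 :> R by rewrite indicE (negbTE wU).
  rewrite mul0r mulr0.
  by apply: integral_ge0 => u _; exact: (g1_ge0 ((v, w), u)).
rewrite !indicE vA wU !mul1r.
pose S := [set u : rV | enorm (post_v v w u - v) <= alpha / 2 * enorm (v - w)].
have -> : (\int[sph]_u (c * chi v w (post_v v w u) * (f v * f w))%:E =
    \int[sph]_u ((c * (f v * f w))%:E * (\1_S u)%:E))%E.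
  apply: eq_integral => u _; rewrite -EFinM; congr EFin.
  suff -> : chi v w (post_v v w u) = \1_S u by ring.
  rewrite /chi !indicE; congr ((nat_of_bool _)%:R).
  move: vA wU; rewrite !inE => vA wU; apply/idP/idP; rewrite !inE.
    by case.
  by [].
have mS : measurable S by exact: mcap.
rewrite ge0_integralZl ?lee_fin ?mulr_ge0 ?(ltW c_gt0)//; last first.
  exact/measurable_EFinP/measurable_indic.
rewrite integral_indic// setIT.
have -> : c * kl * f v * f w = c * (f v * f w) * kl by ring.
rewrite [leLHS]EFinM; apply: lee_wpmul2l.
  by rewrite lee_fin !mulr_ge0// ltW.
move: vA wU; rewrite !inE => vA wU.
have dvw := bulk_distance vA wU; have vw := neq_of_distance dvw.
apply: (sphere_measure_ge d_gt0 (e := direction (v - w))) => //.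
  by rewrite enorm_direction// subr_eq0.
move=> u u1 ue; rewrite /S /= post_vBv enormZ ger0_norm ?divr_ge0 ?enorm_ge0//.
by have := enorm_ge0 (v - w); nra.
Qed.


Let ku := d%:R * 2 ^+ d * ball_volume R d * (4 * eps / delta) ^+ d.-1.

Let ku_ge0 : 0 <= ku.
Proof.
rewrite mulr_ge0 ?exprn_ge0//; last by rewrite divr_ge0 ?mulr_ge0// ltW.
by rewrite mulr_ge0 ?(ltW ball_volume_gt0)// mulr_ge0// exprn_ge0.
Qed.

Let cku_ge0 : 0 <= c * ku.
Proof. by apply: mulr_ge0 => //; exact: ltW. Qed.

Let backward_swap : backward = (\int[mu]_v \int[mu]_w \int[sph]_u
  (c * chi (post_v v w u) (post_w v w u) v * (f v * f w))%:E)%E.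
Proof.
pose H (p : (rV * rV) * (rV * rV)) : \bar R :=
  (c * chi p.1.1 p.1.2 p.2.1 * (f p.2.1 * f p.2.2))%:E.
rewrite /backward -[RHS](integral_pre_post_swap d_gt0 (H := H))//.
- have q11 : measurable_fun setT (fun p : (rV * rV) * (rV * rV) => p.1.1).
    exact: (measurableT_comp measurable_fst measurable_fst).
  have q12 : measurable_fun setT (fun p : (rV * rV) * (rV * rV) => p.1.2).
    exact: (measurableT_comp measurable_snd measurable_fst).
  have q21 : measurable_fun setT (fun p : (rV * rV) * (rV * rV) => p.2.1).
    exact: (measurableT_comp measurable_fst measurable_snd).
  have q22 : measurable_fun setT (fun p : (rV * rV) * (rV * rV) => p.2.2).
    exact: (measurableT_comp measurable_snd measurable_snd).
  apply/measurable_EFinP; apply: measurable_funM.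
    by apply: measurable_funM => //; exact: mchi.
  by apply: measurable_funM; exact: mf_fst2.
- by move=> p; rewrite lee_fin !mulr_ge0// ltW.
Qed.

Lemma mnear (v w : rV) : measurable ((fun u : rV => post_v v w u) @^-1` A).
Proof.
have mp : measurable_fun setT (fun u : rV => post_v v w u).
  exact: (measurableT_comp pv (pair1_measurable (v, w))).
by have := mp measurableT _ (@measurable_eball R d w0 eps); rewrite setTI.
Qed.

(* After the exchange, v' lies in the eps-ball: given v and w, the collision
   parameter lies within 2 eps / |v - w| of a point p. *)
Let backward_le : (backward <= (c * ku)%:E * (mass A' * mass setT))%E.
Proof.
rewrite backward_swap.
rewrite -(integral_product cku_ge0 (@measurable_eball R d w0 _) measurableT).
have cc0 v w v' : 0 <= c * chi v w v' by apply: mulr_ge0; [exact: ltW|exact: chi_ge0].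
have ff0 v w : 0 <= f v * f w by exact: mulr_ge0.
have lhs0 v w u : (0 <= (c * chi (post_v v w u) (post_w v w u) v * (f v * f w))%:E)%E.
  by rewrite lee_fin; apply: mulr_ge0; [exact: cc0|exact: ff0].
apply: le_lower_integral => v _.
  by apply: integral_ge0 => w _; apply: integral_ge0 => u _; exact: lhs0.
apply: le_lower_integral => w _.
  by apply: integral_ge0 => u _; exact: lhs0.
have -> : \1_[set: rV] w = 1 :> R by rewrite indicE in_setT.
rewrite mul1r.
have mlhs : measurable_fun setT (fun u : rV =>
    (c * chi (post_v v w u) (post_w v w u) v * (f v * f w))%:E : \bar R).
  have pv1 : measurable_fun setT (fun u : rV => post_v v w u).
    exact: (measurableT_comp pv (pair1_measurable (v, w))).
  have pw1 : measurable_fun setT (fun u : rV => post_w v w u).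
    exact: (measurableT_comp pw (pair1_measurable (v, w))).
  apply/measurable_EFinP; apply: measurable_funM; last exact: measurable_cst.
  apply: measurable_funM; first exact: measurable_cst.
  by apply: mchi; [exact: pv1|exact: pw1|exact: measurable_cst].
have loc0 : 0 <= c * (\1_A' v * f v) * f w.
  apply: mulr_ge0; last exact: f_ge0.
  by apply: mulr_ge0; [exact: ltW|apply: mulr_ge0; [exact: indicator_ge0|exact: f_ge0]].
have cE : c * ku * (\1_A' v * f v) * f w = c * (\1_A' v * f v) * f w * ku by ring.
have chiP u : enorm u = 1 -> Rg ((post_v v w u, post_w v w u), v) ->
    [/\ A' v, enorm (post_v v w u - w0) < eps & delta / 2 <= enorm (v - w)].
  move=> u1 [/= vA wU near_v].
  have := bulk_distance vA wU; have := bulk_distance_le vA wU.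
  move: near_v; rewrite post_vBw enormZ u1 mulr1 (ger0_norm (enorm_ge0 _)) => near_v.
  move=> le_rho ge_delta; split; [|exact: vA|exact: ge_delta].
  rewrite /eball /=; have := ler_enorm_dist (post_v v w u) v w0.
  have : alpha / 2 * enorm (v - w) <= alpha * rho.
    by have /andP[a0 _] := alpha01; rewrite -mulrA (ler_pM2l a0); lra.
  by move: vA; rewrite /eball /=; lra.
have [vw|vw] := leP (delta / 2) (enorm (v - w)); last first.
  apply: (@le_trans _ _ 0%E); last first.
    by rewrite lee_fin cE; apply: mulr_ge0; [exact: loc0|exact: ku_ge0].
  rewrite -[leRHS](integral0 sph setT).
  apply: (le_lower_integral_conull measurable_unit_sphere sphere_measure_conull);
    [exact: lhs0|exact: mlhs|].
  move=> u /= u1.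
  have [[_ /(chiP _ u1)[_ _]]|->] := grazing_indicator (post_v v w u) (post_w v w u) v.
    by rewrite leNgt vw.
  by rewrite mulr0 mul0r lexx.
have z0 : 0 < enorm (v - w).
  by apply: lt_le_trans vw; apply: divr_gt0; [exact: delta_gt0|exact: ltr0n].
pose S := (fun u : rV => post_v v w u) @^-1` A.
have mS : measurable S by exact: mnear.
apply: (@le_trans _ _ ((c * (\1_A' v * f v) * f w)%:E * sph S)%E).
  have sphE : (\int[sph]_u (\1_S u)%:E = sph S)%E.
    by rewrite (integral_indic _ measurableT mS) setIT.
  rewrite -sphE -(ge0_integralZl _ measurableT); last 3 first.
  - by apply/measurable_EFinP; exact: measurable_indic mS.
  - by move=> u _; rewrite lee_fin; exact: indicator_ge0.
  - by rewrite lee_fin; exact: loc0.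
  apply: (le_lower_integral_conull measurable_unit_sphere sphere_measure_conull);
    [exact: lhs0|exact: mlhs|].
  move=> u /= u1; rewrite -EFinM lee_fin.
  have [[-> /(chiP _ u1)[vA' uS _]]|->] :=
    grazing_indicator (post_v v w u) (post_w v w u) v; last first.
    by rewrite mulr0 mul0r; apply: mulr_ge0; [exact: loc0|exact: indicator_ge0].
  have -> : \1_A' v = 1 :> R by rewrite indicE mem_set.
  have -> : \1_S u = 1 :> R by rewrite indicE mem_set.
  by rewrite !mulr1 mul1r mulrA lexx.
rewrite cE [leRHS]EFinM; apply: lee_wpmul2l; first by rewrite lee_fin; exact: loc0.
pose p := (2 / enorm (v - w)) *: (w0 - 2^-1 *: (v + w)).
have eps4 : 0 < 4 * eps by exact: mulr_gt0.
apply: (sphere_measure_le d_gt0 (p := p) mS).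
  apply/andP; split; first by apply: divr_gt0; [exact: eps4|exact: delta_gt0].
  by rewrite (ltr_pdivrMr _ _ delta_gt0) mul1r; exact: eps_small.
move=> u u1 uS; have -> : u - p = (2 / enorm (v - w)) *: (post_v v w u - w0).
  rewrite /p /post_v (enormBC w v); apply/rowP => i; rewrite !mxE.
  by field; rewrite (gt_eqF z0).
have k0 : 0 < 2 / enorm (v - w) by apply: divr_gt0; [exact: ltr0n|exact: z0].
rewrite enormZ (gtr0_norm k0).
apply: (@lt_le_trans _ _ (2 / enorm (v - w) * eps)).
  by rewrite (ltr_pM2l k0); exact: uS.
rewrite (ler_pdivlMr _ _ delta_gt0).
have -> : 2 / enorm (v - w) * eps * delta = 2 * eps * (delta / enorm (v - w)) by ring.
have -> : 4 * eps = 2 * eps * 2 by ring.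
have eps2 : 0 < 2 * eps by exact: mulr_gt0.
by rewrite (ler_pM2l eps2) (ler_pdivrMr _ _ z0); lra.
Qed.

(** Grazing collisions of the eps-ball with the bulk either produce entropy or are
    balanced by reverse collisions; the latter start within alpha rho + eps of w0
    and must hit the eps-ball, which leaves them the share eps^(d-1) of the
    sphere, against alpha^(d-1) for the forward ones. *)
Lemma grazing_estimate (cPhi gamma bmin : R) (b : R -> R) :
  0 < cPhi -> gamma <= 0 -> (forall x, -1 <= x <= 1 -> 0 <= b x) ->
  0 <= bmin -> (forall a, 0 < a <= alpha -> bmin <= b (1 - a ^+ 2 / 2)) ->
  c = cPhi * (2 * rho) `^ gamma * bmin ->
  ((c * (4 ^- d * ball_volume R d * alpha ^+ d.-1))%:E * (mass A * mass U) <=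
   4%:E * entropy_dissipation cPhi gamma b f +
   (2 * c * (d%:R * 2 ^+ d * ball_volume R d * (4 * eps / delta) ^+ d.-1))%:E *
   (mass A' * mass setT))%E.
Proof.
move=> cPhi0 gam0 b0 bmin0 bb cE; apply: le_trans le_forward _.
apply: le_trans forward_le _; apply: leeD; first exact: (excess_le_dissipation cPhi0 gam0 b0 bmin0).
have -> : 2 * c * (d%:R * 2 ^+ d * ball_volume R d * (4 * eps / delta) ^+ d.-1)
  = c * ku + c * ku by rewrite /ku; ring.
have cku : (0 <= (c * ku)%:E)%E by rewrite lee_fin; exact: cku_ge0.
by rewrite EFinD (ge0_muleDl _ cku cku); apply: leeD; exact: backward_le.
Qed.

End grazing_estimate.

(** * Consequences of bounded mass, energy and entropy *)

Section gaussian_rV.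
Context {R : realType}.

Lemma enorm_rV_cons n (x : R) (v : 'rV[R]_n) :
  enorm (rV_cons (x, v)) ^+ 2 = x ^+ 2 + enorm v ^+ 2.
Proof.
rewrite !enorm_sqr /dotv big_ord_recl rV_cons0 expr2; congr (_ + _).
by apply: eq_bigr => i _; rewrite rV_consS.
Qed.

Lemma measurable_gaussian_rV n :
  measurable_fun setT (fun v : 'rV[R]_n => expR (- enorm v ^+ 2)).
Proof.
apply: (measurableT_comp (@measurable_expR R)).
by apply: measurableT_comp => //; apply: measurable_funX; exact: measurable_enorm.
Qed.

Lemma integral_gaussian_rV n :
  (\int[lebesgue_rV n]_v (expR (- enorm v ^+ 2))%:E = (Num.sqrt (pi : R) ^+ n)%:E)%E.
Proof.
elim: n => [|n IHn].
  have mgauss : measurable_fun setT (fun v : 'rV[R]_0 => (expR (- enorm v ^+ 2))%:E).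
    by apply/measurable_EFinP; exact: measurable_gaussian_rV.
  rewrite integral_dirac//.
  by rewrite diracT mul1e enorm0 expr0n oppr0 expR0 expr0.
have gE (x : R) (v : 'rV[R]_n) : (expR (- enorm (rV_cons (x, v)) ^+ 2))%:E =
    ((gauss_fun x)%:E * (expR (- enorm v ^+ 2))%:E)%E.
  by rewrite enorm_rV_cons opprD expRD EFinM.
rewrite integral_lebesgue_rVS//; last first.
  by apply/measurable_EFinP; exact: measurable_gaussian_rV.
have gauss0 x : (0 <= (@gauss_fun R x)%:E)%E by rewrite lee_fin gauss_fun_ge0.
have inner (x : R) : (\int[lebesgue_rV n]_v (expR (- enorm (rV_cons (x, v)) ^+ 2))%:E =
    (gauss_fun x)%:E * (Num.sqrt (pi : R) ^+ n)%:E)%E.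
  under eq_integral do rewrite gE.
  rewrite ge0_integralZl ?IHn//.
  by apply/measurable_EFinP; exact: measurable_gaussian_rV.
under eq_integral do rewrite inner.
rewrite ge0_integralZr ?integralT_gauss -?EFinM ?exprS//.
by apply/measurable_EFinP; exact: measurable_gauss_fun.
Qed.

End gaussian_rV.

(** Young's inequality for x ln x; it is used with a = |v|^2 to bound the entropy
    from below, and with a negative constant a to exclude concentration. *)
Lemma xlnx_ge (R : realType) (x a : R) : 0 <= x -> - a * x - expR (- a) <= x * ln x.
Proof.
rewrite le_eqVlt => /predU1P[<-|x0].
  by rewrite mulr0 mul0r sub0r oppr_le0 expR_ge0.
have y0 : 0 < x * expR a by rewrite mulr_gt0// expR_gt0.
have : ln (1 + ((x * expR a)^-1 - 1)) <= (x * expR a)^-1 - 1.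
  by apply: le_ln1Dx; rewrite ltrBrDr addNr invr_gt0.
rewrite addrC subrK lnV ?posrE// lnM ?posrE ?expR_gt0// expRK => H.
have E : x * (x * expR a)^-1 = expR (- a).
  by rewrite invfM mulrA divff ?gt_eqF// mul1r expRN.
have : x * (- (ln x + a)) <= x * ((x * expR a)^-1 - 1) by rewrite ler_pM2l.
by rewrite mulrBr E mulr1; lra.
Qed.

Record bounded_density (R : realType) (d : nat) (m0 M0 E0 H0 : R)
    (f : 'rV[R]_d -> R) : Prop := {
  density_measurable : measurable_fun setT f ;
  density_ge0 : forall v, 0 <= f v ;
  density_mass_ge : (m0%:E <= \int[lebesgue_rV d]_v (f v)%:E)%E ;
  density_mass_le : (\int[lebesgue_rV d]_v (f v)%:E <= M0%:E)%E ;
  density_energy_le : (\int[lebesgue_rV d]_v (f v * enorm v ^+ 2)%:E <= E0%:E)%E ;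
  density_entropy_le : (entropy f <= H0%:E)%E }.

Section entropy_bounds.
Context {R : realType} {d : nat}.
Local Notation rV := 'rV[R]_d.
Local Notation mu := (lebesgue_rV d).
Variables (E0 : R) (f : rV -> R).
Hypotheses (mf : measurable_fun setT f) (f0 : forall v, 0 <= f v)
  (energy : (\int[mu]_v (f v * enorm v ^+ 2)%:E <= E0%:E)%E).

Definition negative_entropy_bound : R := E0 + Num.sqrt pi ^+ d.
Local Notation N := negative_entropy_bound.

Let g (v : rV) : \bar R := (f v * ln (f v))%:E.

Let mg : measurable_fun setT g.
Proof.
apply/measurable_EFinP; apply: measurable_funM => //.
exact: (measurableT_comp (@measurable_ln R) mf).
Qed.

Let menergy : measurable_fun setT (fun v : rV => (f v * enorm v ^+ 2)%:E : \bar R).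
Proof.
apply/measurable_EFinP; apply: measurable_funM => //.
by apply: measurable_funX; exact: measurable_enorm.
Qed.

Let energy0 v : (0 <= (f v * enorm v ^+ 2)%:E)%E.
Proof. by rewrite lee_fin mulr_ge0// sqr_ge0. Qed.

Let negative_part_le : (\int[mu]_v g^\- v <= N%:E)%E.
Proof.
apply: (@le_trans _ _ (\int[mu]_v ((f v * enorm v ^+ 2)%:E +
    (expR (- enorm v ^+ 2))%:E))%E).
  apply: le_lower_integral => // v _.
  rewrite funenegE ge_max; apply/andP; split; last first.
    by rewrite adde_ge0// lee_fin expR_ge0.
  rewrite /g -EFinN -EFinD lee_fin.
  by have := @xlnx_ge R (f v) (enorm v ^+ 2) (f0 v); lra.
rewrite ge0_integralD//; last first.
  by apply/measurable_EFinP; exact: measurable_gaussian_rV.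
by rewrite integral_gaussian_rV /N EFinD leeD2r.
Qed.

(** f ln f >= - |v|^2 f - exp (- |v|^2), and the right side is integrable. *)
Lemma entropy_ge : ((- N)%:E <= entropy f)%E.
Proof.
rewrite /entropy integralE EFinN; apply: (@le_trans _ _ (0 - N%:E)%E).
  by rewrite sub0e.
by apply: leeB => //; exact: integral_ge0.
Qed.

Lemma positive_entropy_le (H0 : R) : (entropy f <= H0%:E)%E ->
  (\int[mu]_v g^\+ v <= (H0 + N)%:E)%E.
Proof.
rewrite /entropy integralE => H.
have n0 : (0 <= \int[mu]_v g^\- v)%E by exact: integral_ge0.
have nfin : (\int[mu]_v g^\- v)%E \is a fin_num.
  by rewrite ge0_fin_numE// (le_lt_trans negative_part_le)// ltry.
move: H; rewrite leeBlDr// => H; apply: le_trans H _.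
by rewrite EFinD leeD2l.
Qed.

(** k f <= f ln f + e^k, integrated over the ball. *)
Lemma mass_eball_le (H0 k r : R) (w0 : rV) : (entropy f <= H0%:E)%E ->
  0 < k -> 0 < r ->
  (k%:E * mass f (eball w0 r) <=
   (H0 + N + expR k * (r ^+ d * ball_volume R d))%:E)%E.
Proof.
move=> HH k0 r0; have mB := @measurable_eball R d w0 r.
have mloc : measurable_fun setT (fun v : rV => (\1_(eball w0 r) v * f v)%:E : \bar R).
  by apply/measurable_EFinP; apply: measurable_funM.
rewrite /mass -ge0_integralZl//; last 2 first.
- by move=> v _; rewrite lee_fin mulr_ge0.
- by rewrite lee_fin ltW.
apply: (@le_trans _ _ (\int[mu]_v (g^\+ v + (expR k)%:E * (\1_(eball w0 r) v)%:E))%E).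
  apply: le_lower_integral => v _.
    by rewrite mule_ge0 ?lee_fin ?mulr_ge0// ltW.
  have gp : (g v <= g^\+ v)%E by rewrite funeposE le_max lexx.
  have gp0 : (0 <= g^\+ v)%E by [].
  rewrite indicE; case: (v \in _); rewrite /= ?(mul0r, mule0, mul1r, mule1, adde0)//.
  rewrite -EFinM; apply: le_trans (leeD2r _ gp); rewrite /g -EFinD lee_fin.
  by have := @xlnx_ge R (f v) (- k) (f0 v); rewrite !opprK; lra.
have m1 : measurable_fun setT (fun v => (\1_(eball w0 r) v)%:E : \bar R).
  by apply/measurable_EFinP; exact: measurable_indic.
rewrite ge0_integralD//; last 2 first.
- exact: measurable_funepos.
- exact: measurable_funeM.
rewrite EFinD; apply: leeD; first exact: positive_entropy_le.
rewrite ge0_integralZl//.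
by rewrite integral_indic// setIT EFinM -(lebesgue_eballE w0 r0).
Qed.

End entropy_bounds.

Section bulk_mass.
Context {R : realType} {d : nat}.
Local Notation rV := 'rV[R]_d.
Local Notation mu := (lebesgue_rV d).
Variables (m0 M0 E0 H0 : R).
Hypotheses (d_gt0 : (0 < d)%N) (m0_gt0 : 0 < m0) (E0_gt0 : 0 < E0).

Lemma nonconcentration (eta : R) : 0 < eta ->
  exists2 r, 0 < r & forall (f : rV -> R), bounded_density m0 M0 E0 H0 f ->
    forall w0, (mass f (eball w0 r) <= eta%:E)%E.
Proof.
move=> eta0; pose K := `|H0 + negative_entropy_bound (d := d) E0| + 1.
have K0 : 0 < K by rewrite ltr_wpDl.
(* k reduces the entropy term to eta / 2, and r the volume term. *)
pose k := 2 * K / eta; have k0 : 0 < k by rewrite divr_gt0// mulr_gt0.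
pose B := expR k * ball_volume R d.
have B0 : 0 < B by rewrite mulr_gt0 ?expR_gt0// ball_volume_gt0.
pose r := Num.min 1 (K / B).
have r0 : 0 < r by rewrite lt_min ltr01 divr_gt0.
have r1 : r <= 1 by rewrite ge_min lexx.
have rK : r * B <= K by rewrite -ler_pdivlMr// ge_min lexx orbT.
exists r => // f [mf f0 _ _ fE fH] w0.
have H := mass_eball_le mf f0 fE w0 fH k0 r0.
rewrite -(@lee_pmul2l _ k%:E) ?lte_fin//; apply: le_trans H _.
rewrite -EFinM lee_fin (_ : k * eta = K + K); last first.
  by rewrite /k divfK ?gt_eqF// mulr_natl mulr2n.
apply: lerD.
  by rewrite /K; apply: le_trans (ler_norm _) _; rewrite lerDl.
apply: le_trans rK; rewrite mulrCA -/B ler_wpM2r ?(ltW B0)//.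
by rewrite -[leRHS]expr1 ler_wiXn2l// ltW.
Qed.

(** A quarter of the mass at most is lost near w0, by [nonconcentration], and
    another quarter at large velocities, by the energy bound. *)
Lemma bulk_mass_ge : exists delta rho0, [/\ 0 < delta, 0 < rho0 &
  forall rho, rho0 <= rho -> forall (f : rV -> R), bounded_density m0 M0 E0 H0 f ->
    forall w0, ((m0 / 2)%:E <= mass f (bulk w0 delta rho))%E].
Proof.
have [|delta delta0 Hdelta] := @nonconcentration (m0 / 4); first by rewrite divr_gt0.
exists delta, (Num.max 1 (4 * E0 / m0)).
have e0 : 0 < 4 * E0 / m0 by rewrite divr_gt0// mulr_gt0.
split => //; first by rewrite lt_max ltr01.
move=> rho; rewrite ge_max => /andP[rho1 rhoE] f bf w0.
have [mf f0 fm _ fE _] := bf; have {Hdelta}B4 := Hdelta f bf w0.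
have rho0 : 0 < rho by lra.
have E4 : E0 / rho ^+ 2 <= m0 / 4.
  rewrite ler_pdivrMr ?exprn_gt0//; move: rhoE; rewrite ler_pdivrMr// => rhoE.
  have r2 : rho <= rho ^+ 2 by rewrite ler_eXnr.
  by have : m0 * rho <= m0 * rho ^+ 2; [rewrite ler_pM2l|lra].
have mB := @measurable_eball R d w0 delta; have mU := @measurable_bulk R d w0 delta rho.
have mloc (S : set rV) : measurable S ->
    measurable_fun setT (fun v => (\1_S v * f v)%:E : \bar R).
  by move=> mS; apply/measurable_EFinP; exact: measurable_funM.
have loc0 (S : set rV) v : (0 <= (\1_S v * f v)%:E)%E.
  by rewrite lee_fin mulr_ge0.
have mE : measurable_fun setT (fun v : rV => (f v * enorm v ^+ 2)%:E : \bar R).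
  apply/measurable_EFinP; apply: measurable_funM => //.
  by apply: measurable_funX; exact: measurable_enorm.
have E_ge0 v : (0 <= (f v * enorm v ^+ 2)%:E)%E by rewrite lee_fin mulr_ge0// sqr_ge0.
have r20 : 0 <= rho ^- 2 by rewrite invr_ge0 sqr_ge0.
have split3 : (\int[mu]_v (f v)%:E <= mass f (bulk w0 delta rho) +
    (mass f (eball w0 delta) + (rho ^- 2)%:E * \int[mu]_v (f v * enorm v ^+ 2)%:E))%E.
  rewrite /mass -ge0_integralZl//.
  rewrite -ge0_integralD//; [|exact: mloc| |exact: measurable_funeM]; last first.
    by move=> v _; apply: mule_ge0.
  rewrite -ge0_integralD//; [|exact: mloc| |]; last 2 first.
  - by move=> v _; rewrite adde_ge0// mule_ge0.
  - by apply: emeasurable_funD; [exact: mloc|exact: measurable_funeM].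
  apply: le_lower_integral => v _; first by rewrite lee_fin.
  rewrite -EFinM -!EFinD lee_fin.
  have i0 (S : set rV) : 0 <= \1_S v * f v by rewrite mulr_ge0.
  have e_ge0 : 0 <= rho ^- 2 * (f v * enorm v ^+ 2) by rewrite mulr_ge0// mulr_ge0// sqr_ge0.
  have [vB|vB] := pselect (eball w0 delta v).
    have : \1_(eball w0 delta) v * f v = f v by rewrite indicE mem_set// mul1r.
    by have := i0 (bulk w0 delta rho); lra.
  have [vr|vr] := leP (enorm v) rho.
    have : \1_(bulk w0 delta rho) v * f v = f v.
      rewrite indicE mem_set ?mul1r//; split => //.
      by rewrite leNgt; apply/negP.
    by have := i0 (eball w0 delta); lra.
  have : f v <= rho ^- 2 * (f v * enorm v ^+ 2).
    rewrite mulrCA -[leLHS]mulr1 ler_wpM2l// mulrC ler_pdivlMr ?exprn_gt0// mul1r.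
    by rewrite lerXn2r ?nnegrE ?(ltW rho0) ?enorm_ge0// ltW.
  by have := i0 (eball w0 delta); have := i0 (bulk w0 delta rho); lra.
have E2 : ((rho ^- 2)%:E * \int[mu]_v (f v * enorm v ^+ 2)%:E <= (m0 / 4)%:E)%E.
  apply: (@le_trans _ _ ((rho ^- 2)%:E * E0%:E)%E); first exact: lee_wpmul2l.
  by rewrite -EFinM lee_fin mulrC.
have : (m0%:E <= mass f (bulk w0 delta rho) + (m0 / 2)%:E)%E.
  apply: le_trans fm _; apply: le_trans split3 _; apply: leeD2l.
  rewrite (_ : m0 / 2 = m0 / 4 + m0 / 4); last by field.
  by rewrite EFinD; exact: leeD.
rewrite -leeBlDr// -EFinB; apply: le_trans; rewrite lee_fin; lra.
Qed.

End bulk_mass.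

(** * Mass of small balls *)

Section scale_iteration.
Context {R : realType}.

(** Summing the recursion over geometric scales: the factor q lambda^p <= 1/2
    makes the scale-invariant quantity mu e / e^p contract up to a source. *)
Lemma scale_iteration (mu : R -> R) (lambda p M A q e1 : R) :
  2 <= lambda -> 0 < p -> 0 <= M -> 0 <= A -> 0 <= q -> 0 < e1 ->
  q * lambda `^ p <= 1 / 2 ->
  (forall e, 0 < e -> mu e <= M) ->
  (forall e, 0 < e -> e < e1 -> mu e <= A * e `^ p + q * mu (lambda * e)) ->
  forall e, 0 < e -> mu e <= e `^ p * (2 * A + M * e1 `^ (- p)).
Proof.
move=> lam2 p0 M0 A0 q0 e10 ql muM step; set K := 2 * A + _.
have K0 : 0 <= K by rewrite addr_ge0 ?mulr_ge0// powR_ge0.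
have large e : 0 < e -> e1 <= e -> mu e <= e `^ p * K.
  move=> e0 e1e; apply: le_trans (muM e e0) _.
  have : M * 1 <= M * (e `^ p * e1 `^ (- p)).
    rewrite ler_wpM2l// powRN ler_pdivlMr ?powR_gt0// mul1r.
    by rewrite ge0_ler_powR ?nnegrE// ?(ltW p0) ?(ltW e0) ?(ltW e10).
  have : 0 <= e `^ p * (2 * A) by rewrite mulr_ge0 ?powR_ge0 ?mulr_ge0.
  by rewrite /K mulrDr mulr1 (mulrCA (e `^ p)); lra.
have ind n : forall e, 0 < e -> e1 <= lambda ^+ n * e -> mu e <= e `^ p * K.
  elim: n => [|n IHn] e e0; first by rewrite expr0 mul1r; exact: large.
  rewrite exprSr -mulrA => H; have [?|ee1] := leP e1 e; first exact: large.
  have le0 : 0 < lambda * e by rewrite mulr_gt0//; lra.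
  apply: le_trans (step e e0 ee1) _.
  have : q * mu (lambda * e) <= q * ((lambda * e) `^ p * K).
    by rewrite ler_wpM2l// IHn.
  rewrite powRM ?(ltW e0)//; last by lra.
  have ep : 0 <= e `^ p * K by rewrite mulr_ge0// powR_ge0.
  have : (q * lambda `^ p) * (e `^ p * K) <= 1 / 2 * (e `^ p * K) by rewrite ler_wpM2r.
  have : A * e `^ p <= 1 / 2 * (e `^ p * K).
    rewrite mulrCA mulrC ler_wpM2l ?powR_ge0// /K.
    have : 0 <= M * e1 `^ (- p) by rewrite mulr_ge0 ?powR_ge0.
    by lra.
  have -> : q * (lambda `^ p * e `^ p * K) = q * lambda `^ p * (e `^ p * K) by ring.
  by lra.
move=> e e0; pose n := (Num.trunc (e1 / e)).+1.
apply: (ind n) => //.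
have n0 : e1 / e < n%:R by rewrite truncnS_gt.
have n2 : (n%:R : R) <= lambda ^+ n.
  have : forall k : nat, (k%:R : R) <= lambda ^+ k.
    elim=> [|k IHk]; first by rewrite expr0.
    rewrite exprS; apply: (@le_trans _ _ (2 * lambda ^+ k)); last first.
      by rewrite ler_wpM2r// exprn_ge0//; lra.
    have : 1 <= lambda ^+ k by rewrite exprn_ege1//; lra.
    by rewrite -natr1; lra.
  exact.
by rewrite -ler_pdivrMr//; apply: le_trans n2; exact: ltW.
Qed.

End scale_iteration.

Section mass_of_balls.
Context {R : realType} {d : nat}.
Local Notation rV := 'rV[R]_d.
Variables (m0 M0 E0 H0 gamma s cPhi : R) (b : R -> R).
Hypotheses (d_ge3 : (3 <= d)%N) (m0_gt0 : 0 < m0) (M0_gt0 : 0 < M0)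
  (E0_gt0 : 0 < E0) (gamma_le0 : gamma <= 0) (s01 : 0 < s < 1)
  (cPhi_gt0 : 0 < cPhi) (b_angular : angular_kernel d s b).

Let d_gt0 : (0 < d)%N. Proof. exact: leq_trans d_ge3. Qed.

Lemma mass_le_total (f : rV -> R) (S : set rV) :
  measurable_fun setT f -> (forall v, 0 <= f v) -> measurable S ->
  (mass f S <= \int[lebesgue_rV d]_v (f v)%:E)%E.
Proof.
move=> mf f0 mS; apply: le_lower_integral => v _.
  by rewrite lee_fin mulr_ge0.
by rewrite lee_fin indicE; case: (_ \in _); rewrite ?mul1r ?mul0r.
Qed.

(** [grazing_estimate] with alpha = L e, divided by the coefficient of the left
    side: the kernel alpha^(-(d-1)-2s) times a cap of measure alpha^(d-1) gives
    alpha^(-2s), and reverse collisions carry the extra factor L^(-(d-1)). *)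
Lemma mass_eball_step (delta rho : R) : 0 < delta -> 1 <= rho ->
  (forall f : rV -> R, bounded_density m0 M0 E0 H0 f ->
    forall w0, ((m0 / 2)%:E <= mass f (bulk w0 delta rho))%E) ->
  exists P Q, [/\ 0 < P, 0 < Q &
    forall L, 1 <= L -> exists2 e1, 0 < e1 &
    forall f : rV -> R, bounded_density m0 M0 E0 H0 f ->
    forall D, (entropy_dissipation cPhi gamma b f <= D%:E)%E ->
    forall w0, enorm w0 + 1 <= rho -> forall e, 0 < e -> e < e1 ->
    fine (mass f (eball w0 e)) <= P * L `^ (2 * s) * D * e `^ (2 * s) +
      Q * L ^- d.-1 * fine (mass f (eball w0 ((1 + L * rho) * e)))].
Proof.
move=> delta0 rho1 bulkP.
have [|//|cb cb0 cbP] := @angular_kernel_ge R d s b _ _ b_angular.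
  exact: leq_trans d_ge3.
  by case/andP: s01.
have rho0 : 0 < 2 * rho by lra.
have [_ b0 _] := b_angular.
pose P0 := cPhi * (2 * rho) `^ gamma * cb * (4 ^- d * ball_volume R d).
have P00 : 0 < P0.
  rewrite !mulr_gt0// ?powR_gt0// ?invr_gt0 ?exprn_gt0//; exact: ball_volume_gt0.
pose Q0 := (d%:R * 2 ^+ d * ball_volume R d * (4 / delta) ^+ d.-1) /
  (4 ^- d * ball_volume R d).
have Q00 : 0 < Q0.
  have bv := @ball_volume_gt0 R d.
  by rewrite divr_gt0 ?mulr_gt0 ?exprn_gt0 ?invr_gt0 ?exprn_gt0 ?ltr0n ?divr_gt0.
exists (8 / (P0 * m0)), (4 * M0 / m0 * Q0); split.
- by rewrite divr_gt0// mulr_gt0.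
- by rewrite mulr_gt0// divr_gt0// mulr_gt0.
move=> L L1; have L0 : 0 < L by lra.
(* e < 1 / L keeps the chord alpha below 1. *)
exists (Num.min (Num.min 1 (delta / 4)) L^-1).
  by rewrite !lt_min ltr01 divr_gt0//= invr_gt0.
move=> f bf D DD w0 w0rho e e0; rewrite !lt_min => /andP[/andP[e1 ed] eL].
have [mf f0 _ fM _ _] := bf.
pose alpha := L * e.
have alpha0 : 0 < alpha by rewrite mulr_gt0.
have alpha1 : alpha < 1 by rewrite /alpha mulrC -ltr_pdivlMr// div1r.
pose kap : R := d.-1%:R + 2 * s.
pose bmin := cb * alpha `^ (- kap).
have bmin0 : 0 < bmin by rewrite mulr_gt0// powR_gt0.
pose c := cPhi * (2 * rho) `^ gamma * bmin.
have c0 : 0 < c by rewrite !mulr_gt0// powR_gt0.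
have bminP a : 0 < a <= alpha -> bmin <= b (1 - a ^+ 2 / 2).
  by move=> aa; apply: cbP => //; exact: ltW.
have h2 : 4 * e < delta by lra.
have h3 : enorm w0 + e <= rho by lra.
have h4 : 0 < alpha < 1 by rewrite alpha0.
have EST := grazing_estimate d_gt0 e0 h3 h4 h2 c0 mf f0 cPhi_gt0 gamma_le0 b0
  (ltW bmin0) bminP erefl.
have eE : e + alpha * rho = (1 + L * rho) * e by rewrite /alpha; ring.
rewrite eE in EST.
set kl := 4 ^- d * ball_volume R d * alpha ^+ d.-1 in EST.
set ku := d%:R * 2 ^+ d * ball_volume R d * (4 * e / delta) ^+ d.-1 in EST.
have bv := @ball_volume_gt0 R d.
have kl0 : 0 < kl by rewrite !mulr_gt0 ?exprn_gt0 ?invr_gt0 ?exprn_gt0.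
have ku0 : 0 < ku.
  by rewrite !mulr_gt0 ?exprn_gt0 ?ltr0n ?divr_gt0 ?mulr_gt0.
have mass_fin S : measurable S -> mass f S = (fine (mass f S))%:E.
  move=> mS; rewrite fineK// ge0_fin_numE ?mass_ge0//.
  apply: le_lt_trans (mass_le_total mf f0 mS) _.
  by apply: le_lt_trans fM _; rewrite ltry.
have mball e' : mass f (eball w0 e') = (fine (mass f (eball w0 e')))%:E.
  by apply: mass_fin; exact: measurable_eball.
have real_est : c * kl * (fine (mass f (eball w0 e)) * (m0 / 2)) <=
    4 * D + 2 * c * ku * (fine (mass f (eball w0 ((1 + L * rho) * e))) * M0).
  rewrite -lee_fin; apply: (@le_trans _ _ ((c * kl)%:E *
      (mass f (eball w0 e) * mass f (bulk w0 delta rho)))%E).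
    rewrite [X in (_ <= _ * (X * _))%E]mball EFinM; apply: lee_wpmul2l.
      by rewrite lee_fin mulr_ge0 ?(ltW c0) ?(ltW kl0).
    rewrite EFinM; apply: lee_wpmul2l; last exact: bulkP.
    by rewrite lee_fin fine_ge0//; exact: mass_ge0.
  apply: le_trans EST _; rewrite [leRHS]EFinD; apply: leeD.
    by rewrite [leRHS]EFinM; apply: lee_wpmul2l.
  have cku0 : 0 <= 2 * c * ku by apply: mulr_ge0; [apply: mulr_ge0 => //; exact: ltW|exact: ltW].
  rewrite [leRHS]EFinM; apply: lee_wpmul2l; first by rewrite lee_fin.
  rewrite [X in (X * _ <= _)%E]mball [leRHS]EFinM; apply: lee_wpmul2l.
    by rewrite lee_fin fine_ge0//; exact: mass_ge0.
  by apply: le_trans fM; apply: mass_le_total.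
set x := fine (mass f (eball w0 e)) in real_est *.
set y := fine (mass f (eball w0 ((1 + L * rho) * e))) in real_est *.
pose a2 := alpha `^ (2 * s).
have a20 : 0 < a2 by exact: powR_gt0.
have kap_split : alpha `^ (- kap) = (alpha ^+ d.-1)^-1 * a2^-1.
  rewrite powRN powRD ?invfM ?powR_mulrn ?(ltW alpha0)//.
  by apply/implyP => _; rewrite gt_eqF.
have ad0 : alpha ^+ d.-1 != 0 by rewrite gt_eqF// exprn_gt0.
have cklE : c * kl = P0 / a2.
  by rewrite /c /bmin kap_split /kl /P0; field; rewrite ad0 !gt_eqF ?exprn_gt0.
have e_pow : e ^+ d.-1 = alpha ^+ d.-1 * L ^- d.-1.
  by rewrite /alpha exprMn mulrAC divff ?mul1r// gt_eqF// exprn_gt0.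
have ckuE : c * ku = P0 * (Q0 * L ^- d.-1) / a2.
  rewrite /c /bmin kap_split /ku /P0 /Q0 !exprMn e_pow.
  by field; rewrite ad0 !gt_eqF ?exprn_gt0.
have -> : e `^ (2 * s) = a2 / L `^ (2 * s).
  by rewrite /a2 /alpha powRM ?(ltW e0) ?(ltW L0)// mulrAC divff ?mul1r// gt_eqF// powR_gt0.
have Ls0 : 0 < L `^ (2 * s) by exact: powR_gt0.
have k0 : 0 < P0 * m0 / (2 * a2) by rewrite divr_gt0// mulr_gt0.
rewrite -(ler_pM2l k0).
have E1 : P0 * m0 / (2 * a2) * x = c * kl * (x * (m0 / 2)).
  by rewrite cklE; field; rewrite gt_eqF.
have E2 : P0 * m0 / (2 * a2) * (8 / (P0 * m0) * L `^ (2 * s) * D * (a2 / L `^ (2 * s)) +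
    4 * M0 / m0 * Q0 * L ^- d.-1 * y) = 4 * D + 2 * c * ku * (y * M0).
  rewrite -[2 * c * ku]mulrA ckuE; set Ld := L ^- d.-1.
  by field; rewrite !gt_eqF.
by rewrite E1 E2.
Qed.

(** A ball of radius e carries mass at most e^(2s), up to dissipation: since
    d - 1 >= 2 > 2 s, a large deviation ratio L makes the recursion contract. *)
Lemma mass_eball_power (r : R) : 0 < r ->
  exists C1 C2, [/\ 0 < C1, 0 < C2 &
    forall f : rV -> R, bounded_density m0 M0 E0 H0 f ->
    forall D, 0 <= D -> (entropy_dissipation cPhi gamma b f <= D%:E)%E ->
    forall w0, enorm w0 < r -> forall e, 0 < e ->
    (mass f (eball w0 e) <= (e `^ (2 * s) * (C1 * D + C2))%:E)%E].
Proof.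
move=> r0; have [s0 s1] := andP s01.
have [delta [rho0 [delta0 rho00 bulkP]]] := @bulk_mass_ge R d m0 M0 E0 H0 d_gt0 m0_gt0 E0_gt0.
pose rho := Num.max rho0 (r + 1).
have rho_r : r + 1 <= rho by rewrite le_max lexx orbT.
have rho1 : 1 <= rho by lra.
have := @mass_eball_step delta rho delta0 rho1.
case=> [|P [Q [P0 Q0 step]]].
  by move=> f bf w0; apply: bulkP => //; rewrite le_max lexx.
(* C4 L^(2 s - 2) bounds the contraction factor, and L makes it at most 1 / 2. *)
pose C4 := Q * (2 * rho) `^ (2 * s).
have C40 : 0 < C4 by rewrite mulr_gt0// powR_gt0; lra.
pose L := Num.max 1 ((2 * C4) `^ (2 - 2 * s)^-1).
have L1 : 1 <= L by rewrite le_max lexx.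
have L0 : 0 < L by lra.
have Lq : 2 * C4 <= L `^ (2 - 2 * s).
  have s2 : 0 < 2 - 2 * s by lra.
  have -> : 2 * C4 = ((2 * C4) `^ (2 - 2 * s)^-1) `^ (2 - 2 * s).
    by rewrite -powRrM mulVf ?(gt_eqF s2)// powRr1// mulr_ge0// ltW.
  by rewrite ge0_ler_powR ?nnegrE ?powR_ge0 ?(ltW L0) ?le_max ?lexx ?orbT//; lra.
have [e1 e10 {}step] := step L L1.
pose lam := 1 + L * rho.
have Lrho : 1 <= L * rho by rewrite -[leLHS]mulr1 ler_pM.
have lam2 : 2 <= lam by rewrite /lam; lra.
have qlam : Q * L ^- d.-1 * lam `^ (2 * s) <= 1 / 2.
  apply: (@le_trans _ _ (Q * (L `^ 2)^-1 * (2 * rho * L) `^ (2 * s))).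
    apply: ler_pM.
    - by rewrite mulr_ge0 ?(ltW Q0)// invr_ge0 exprn_ge0// ltW.
    - exact: powR_ge0.
    - rewrite ler_pM2l// lef_pV2 ?posrE ?powR_gt0 ?exprn_gt0//.
      rewrite powR_mulrn ?(ltW L0)// ler_weXn2l//.
      by rewrite -ltnS prednK.
    - rewrite ge0_ler_powR ?nnegrE//; [lra|lra|nra|].
      by rewrite /lam; lra.
  rewrite powRM ?(ltW L0)//; last by lra.
  rewrite (_ : Q * _ * _ = C4 * (L `^ (2 * s) / L `^ 2)); last by rewrite /C4; ring.
  have -> : L `^ (2 * s) / L `^ 2 = (L `^ (2 - 2 * s))^-1.
    rewrite -powRB; last by apply/implyP => _; rewrite gt_eqF.
    by rewrite -powRN; congr (L `^ _); ring.
  by rewrite ler_pdivrMr ?powR_gt0//; lra.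
exists (2 * (P * L `^ (2 * s))), (M0 * e1 `^ (- (2 * s))); split.
- by rewrite !mulr_gt0// powR_gt0.
- by rewrite mulr_gt0// powR_gt0.
move=> f bf D D0 DD w0 w0r e e0; have [mf f0 _ fM _ _] := bf.
have massM e' : (mass f (eball w0 e') <= M0%:E)%E.
  by apply: le_trans fM; apply: mass_le_total => //; exact: measurable_eball.
have mass_fin e' : mass f (eball w0 e') = (fine (mass f (eball w0 e')))%:E.
  rewrite fineK// ge0_fin_numE ?mass_ge0//.
  by apply: le_lt_trans (massM e') _; rewrite ltry.
rewrite mass_fin lee_fin.
have := @scale_iteration R (fun e => fine (mass f (eball w0 e))) lam (2 * s) M0
  (P * L `^ (2 * s) * D) (Q * L ^- d.-1) e1.
move=> /(_ lam2) H.
have -> : 2 * (P * L `^ (2 * s)) * D = 2 * (P * L `^ (2 * s) * D) by ring.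
apply: H => //.
- by rewrite mulr_gt0.
- exact: ltW.
- by rewrite !mulr_ge0 ?powR_ge0 ?(ltW P0).
- by rewrite mulr_ge0 ?(ltW Q0)// invr_ge0 exprn_ge0// ltW.
- by move=> e' _; rewrite -lee_fin -mass_fin.
- by move=> e' e'0 e'1; apply: step => //; lra.
Qed.

End mass_of_balls.

(** * The interaction integral *)

Section dissipation_ge0.
Context {R : realType} {d : nat}.

Lemma entropy_dissipation_ge0 (cPhi gamma : R) (b : R -> R) (f : 'rV[R]_d -> R) :
  0 < cPhi -> (forall x, -1 <= x <= 1 -> 0 <= b x) -> (forall v, 0 <= f v) ->
  (0 <= entropy_dissipation cPhi gamma b f)%E.
Proof.
move=> cPhi0 b0 f0; apply: mule_ge0; first by rewrite lee_fin.
apply: integral_ge0 => v _; apply: integral_ge0 => w _.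
rewrite -[leLHS](integral0 (sphere_measure d) setT).
apply: (le_lower_integral_conull measurable_unit_sphere sphere_measure_conull) => //.
move=> u /= u1; apply: mule_ge0; first by rewrite entropy_gap_ge0// mulr_ge0.
rewrite lee_fin mulr_ge0 ?b0 ?cos_deviation_itv//.
by rewrite mulr_ge0 ?powR_ge0// ltW.
Qed.

End dissipation_ge0.

Section dyadic.
Context {R : realType}.

Lemma geometric_sum_le (A x : R) : 0 <= A -> 0 <= x < 1 ->
  (\sum_(k <oo) (A * x ^+ k)%:E <= (A / (1 - x))%:E)%E.
Proof.
move=> A0 /andP[x0 x1]; have x10 : 0 < 1 - x by rewrite subr_gt0.
apply: lime_le.
  by apply: is_cvg_nneseries => n _ _; rewrite lee_fin mulr_ge0// exprn_ge0.
apply: nearW => n; rewrite sumEFin lee_fin ler_pdivlMr//.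
rewrite big_mkord -mulr_sumr -mulrA ler_piMr//.
by have := subrX1 x n; have : 0 <= x ^+ n by [rewrite exprn_ge0]; set S := \sum_(_ < _) _; lra.
Qed.

Lemma dyadic_shell (rho t : R) : 0 < t -> t < rho ->
  exists k : nat, rho / 2 ^+ k.+1 <= t < rho / 2 ^+ k.
Proof.
move=> t0 trho; have rho0 : 0 < rho by lra.
have ex : exists n : nat, rho / 2 ^+ n <= t.
  pose n := (Num.trunc (rho / t)).+1; exists n.
  have n0 : rho / t < n%:R by rewrite truncnS_gt.
  have n2 : (n%:R : R) <= 2 ^+ n by rewrite -natrX ler_nat ltnW// ltn_expl.
  rewrite ler_pdivrMr ?exprn_gt0// mulrC -ler_pdivrMr//.
  by apply: le_trans n2; exact: ltW.
case: (ex_minnP ex) => [[|k] ht kmin].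
  by move: ht; rewrite expr0 divr1 leNgt trho.
exists k; rewrite ht/= ltNge; apply/negP => /kmin; by rewrite ltnn.
Qed.

End dyadic.

Section potential.
Context {R : realType} {d : nat}.
Local Notation rV := 'rV[R]_d.
Local Notation mu := (lebesgue_rV d).

(** If balls of radius e around w carry mass at most S e^p, then the potential
    of order beta < p is bounded, by summing over dyadic shells. *)
Lemma potential_le (f : rV -> R) (w : rV) (rho beta p S : R) :
  measurable_fun setT f -> (forall v, 0 <= f v) -> 0 < rho ->
  0 < beta -> beta < p -> 0 <= S ->
  (forall e, 0 < e -> (mass f (eball w e) <= (e `^ p * S)%:E)%E) ->
  (\int[mu]_v (\1_(eball w rho) v * (f v * enorm (v - w) `^ (- beta)))%:E <=
   (2 `^ beta * rho `^ (p - beta) / (1 - 2 `^ (beta - p)) * S)%:E)%E.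
Proof.
move=> mf f0 rho0 beta0 betap S0 massP.
pose e k : R := rho / 2 ^+ k.
have e0 k : 0 < e k by rewrite divr_gt0// exprn_gt0.
pose phi k v : \bar R := ((2 `^ beta * e k `^ (- beta))%:E *
  (\1_(eball w (e k)) v * f v)%:E)%E.
have phi0 k v : (0 <= phi k v)%E.
  by rewrite mule_ge0// lee_fin mulr_ge0 ?powR_ge0.
have mloc k : measurable_fun setT (fun v => (\1_(eball w (e k)) v * f v)%:E : \bar R).
  apply/measurable_EFinP; apply: measurable_funM => //.
  by apply: measurable_indic; exact: measurable_eball.
have mphi k : measurable_fun setT (phi k) by exact: measurable_funeM.
apply: (@le_trans _ _ (\int[mu]_v (\sum_(k <oo) phi k v))%E).
  apply: le_lower_integral => v _.
    by rewrite lee_fin mulr_ge0// mulr_ge0// powR_ge0.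
  have sum0 : (0 <= \sum_(k <oo) phi k v)%E by exact: nneseries_ge0.
  have [vw|vw] := boolP (v \in eball w rho); last first.
    by rewrite indicE (negbTE vw) mul0r.
  rewrite indicE vw mul1r; move: vw; rewrite inE /eball /= => vw.
  have [vw0|vw0] := eqVneq (enorm (v - w)) 0.
    by rewrite vw0 powR0 ?mulr0// oppr_eq0 gt_eqF.
  have t0 : 0 < enorm (v - w) by rewrite lt_neqAle eq_sym vw0 enorm_ge0.
  have [k /andP[tk1 tk]] := dyadic_shell t0 vw.
  apply: (@le_trans _ _ (phi k v)); last first.
    apply: le_trans (nneseries_lim_ge k.+1 _) => //.
    by rewrite big_nat_recr//= leeDr// sume_ge0.
  rewrite /phi -EFinM lee_fin indicE mem_set// mul1r mulrC ler_wpM2r//.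
  rewrite !powRN -[2 `^ beta]invrK -invfM lef_pV2 ?posrE ?powR_gt0//; last first.
    by rewrite mulr_gt0 ?invr_gt0 ?powR_gt0.
  have -> : (2 `^ beta)^-1 * e k `^ beta = (rho / 2 ^+ k.+1) `^ beta.
    rewrite /e exprSr invfM mulrA [RHS]powRM ?(ltW (e0 k))// mulrC.
    by rewrite -(@powR_inv1 _ 2)// -powRrM mulN1r powRN.
  rewrite ge0_ler_powR ?nnegrE ?(ltW beta0) ?(ltW t0)//.
  by rewrite divr_ge0 ?exprn_ge0// ltW.
rewrite integral_nneseries//.
have x01 : 0 <= (2 : R) `^ (beta - p) < 1.
  rewrite powR_ge0/= -opprB powRN invf_lt1 ?powR_gt0//.
  have pb : 0 < p - beta by lra.
  have := @gt0_ltr_powR R _ pb 1 2; rewrite powR1; apply; rewrite ?nnegrE//.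
  by rewrite ltr1n.
have A0 : 0 <= 2 `^ beta * rho `^ (p - beta) * S.
  by rewrite mulr_ge0// mulr_ge0// powR_ge0.
apply: le_trans (le_trans _ (geometric_sum_le A0 x01)) _; last first.
  by rewrite lee_fin le_eqVlt; apply/orP; left; apply/eqP; ring.
apply: lee_nneseries => [k _ _|k _]; first exact: integral_ge0.
rewrite ge0_integralZl//; last 2 first.
- by move=> v _; rewrite lee_fin mulr_ge0.
- by rewrite lee_fin mulr_ge0 ?powR_ge0.
apply: (@le_trans _ _ ((2 `^ beta * e k `^ (- beta))%:E * (e k `^ p * S)%:E)%E).
  apply: lee_wpmul2l; first by rewrite lee_fin mulr_ge0 ?powR_ge0.
  exact: massP.
rewrite -EFinM lee_fin le_eqVlt; apply/orP; left; apply/eqP.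
have -> : 2 `^ beta * e k `^ (- beta) * (e k `^ p * S) =
    2 `^ beta * S * (e k `^ (- beta) * e k `^ p) by ring.
rewrite -powRD; last by apply/implyP => _; rewrite gt_eqF.
rewrite (addrC (- beta)) /e powRM ?(ltW rho0) ?invr_ge0 ?exprn_ge0//.
have -> : (2 ^- k) `^ (p - beta) = (2 `^ (beta - p)) ^+ k :> R.
  rewrite -powR_invn// -powRrM -[RHS]powR_mulrn ?powR_ge0// -powRrM.
  by congr (2 `^ _); ring.
by ring.
Qed.

End potential.

Section interaction.
Context {R : realType} {d : nat}.
Local Notation rV := 'rV[R]_d.
Local Notation mu := (lebesgue_rV d).

Definition interaction (gamma r : R) (f : rV -> R) : \bar R :=
  (\int[mu]_(w in [set w : rV | (enorm w < r)%R])
     \int[mu]_(v in [set v : rV | (enorm v < r)%R])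
    (f v * f w * enorm (v - w) `^ (gamma + 2))%:E)%E.

Let eball0 (r : R) : [set w : rV | enorm w < r] = eball 0 r.
Proof. by apply/seteqP; split => v; rewrite /eball /= subr0. Qed.

Lemma interaction_le (gamma r K M0 : R) (f : rV -> R) :
  measurable_fun setT f -> (forall v, 0 <= f v) -> 0 <= K ->
  (\int[mu]_v (f v)%:E <= M0%:E)%E ->
  (forall w, enorm w < r ->
    (\int[mu]_(v in [set v : rV | (enorm v < r)%R])
      (f v * enorm (v - w) `^ (gamma + 2))%:E <= K%:E)%E) ->
  (interaction gamma r f <= (K * M0)%:E)%E.
Proof.
move=> mf f0 K0 fM H; have mB := @measurable_eball R d 0 r.
apply: (@le_trans _ _ (K%:E * \int[mu]_w (f w)%:E)%E); last first.
  by rewrite EFinM; apply: lee_wpmul2l.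
have mfE : measurable_fun setT (fun v => (f v)%:E : \bar R) by exact/measurable_EFinP.
have fE0 v : (0 <= (f v)%:E)%E by rewrite lee_fin.
rewrite -ge0_integralZl//.
rewrite /interaction eball0 [leLHS]integral_mkcond.
have ige0 (D : set rV) w : (0 <= \int[mu]_(v in D) (f v * f w * enorm (v - w) `^ (gamma + 2))%:E)%E.
  by apply: integral_ge0 => v _; rewrite lee_fin mulr_ge0 ?powR_ge0// mulr_ge0.
apply: le_lower_integral => w _; first exact: erestrict_ge0.
have [wr|wr] := boolP (w \in eball 0 r); last first.
  by rewrite patchN// mule_ge0 ?lee_fin.
rewrite patchT//; move: wr; rewrite -eball0 inE /= => wr.
rewrite muleC; apply: le_trans (lee_wpmul2l _ (H w wr)); last by rewrite lee_fin.
have mpot : measurable_fun (eball 0 r)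
    (fun v => (f v * enorm (v - w) `^ (gamma + 2))%:E : \bar R).
  apply: measurable_funTS; apply/measurable_EFinP; apply: measurable_funM => //.
  apply: (measurableT_comp (measurable_powR _)).
  by apply: measurable_fun_enorm; exact: measurable_rVB.
have pot0 v : eball 0 r v -> (0 <= (f v * enorm (v - w) `^ (gamma + 2))%:E)%E.
  by move=> _; rewrite lee_fin mulr_ge0 ?powR_ge0.
rewrite eball0 -(ge0_integralZl _ mB mpot pot0)//.
by apply: le_lower_integral => v _; rewrite -?EFinM lee_fin ?mulr_ge0 ?powR_ge0//;
  rewrite le_eqVlt; apply/orP; left; apply/eqP; ring.
Qed.

End interaction.

Section interaction_dissipation.
Context {R : realType} {d : nat}.
Local Notation rV := 'rV[R]_d.
Local Notation mu := (lebesgue_rV d).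
Variables (m0 M0 E0 H0 gamma s cPhi : R) (b : R -> R).
Hypotheses (m0_gt0 : 0 < m0) (M0_gt0 : 0 < M0)
  (E0_gt0 : 0 < E0) (gamma_range : - d%:R < gamma <= 0) (s01 : 0 < s < 1)
  (gamma_2s : - 2 < gamma + 2 * s)
  (cPhi_gt0 : 0 < cPhi) (b_angular : angular_kernel d s b).

(** For gamma >= -2 the weight is bounded on the ball. For gamma < -2 the
    dimension is at least 3, and the potential of order -(gamma + 2) < 2 s is
    bounded through [mass_eball_power] and [potential_le]. *)
Lemma interaction_le_dissipation (r : R) : 0 < r ->
  exists c C, [/\ 0 < c, 0 <= C &
    forall f : rV -> R, bounded_density m0 M0 E0 H0 f ->
    (interaction gamma r f <= c%:E * entropy_dissipation cPhi gamma b f + C%:E)%E].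
Proof.
move=> r0; have /andP[gd g0] := gamma_range; have [_ b0 _] := b_angular.
have [g2|g2] := leP (- 2) gamma.
  exists 1, ((2 * r) `^ (gamma + 2) * M0 * M0); split => //.
    by rewrite !mulr_ge0 ?powR_ge0 ?(ltW M0_gt0).
  move=> f [mf f0 _ fM _ _].
  apply: (@le_trans _ _ ((2 * r) `^ (gamma + 2) * M0 * M0)%:E); last first.
    by rewrite mul1e leeDr//; exact: entropy_dissipation_ge0.
  apply: interaction_le => //; first by rewrite mulr_ge0 ?powR_ge0 ?(ltW M0_gt0).
  move=> w wr; apply: (@le_trans _ _ (((2 * r) `^ (gamma + 2))%:E * \int[mu]_v (f v)%:E)%E).
    have mfE : measurable_fun setT (fun v => (f v)%:E : \bar R) by exact/measurable_EFinP.
    have fE0 v : (0 <= (f v)%:E)%E by rewrite lee_fin.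
    rewrite -ge0_integralZl// ?lee_fin ?powR_ge0//.
    rewrite [leLHS]integral_mkcond; apply: le_lower_integral => v _.
      by apply: erestrict_ge0 => u _; rewrite lee_fin mulr_ge0 ?powR_ge0.
    rewrite /patch; case: ifPn => [|_]; last first.
      by rewrite mule_ge0// lee_fin ?powR_ge0.
    rewrite inE /= => vr; rewrite -EFinM lee_fin mulrC ler_wpM2r//.
    have vw : enorm (v - w) <= 2 * r.
      by have := ler_enormD v (- w); rewrite enormN; lra.
    by rewrite ge0_ler_powR ?nnegrE ?enorm_ge0//; lra.
  by rewrite EFinM; apply: lee_wpmul2l; rewrite ?lee_fin ?powR_ge0.
have d_ge3 : (3 <= d)%N.
  rewrite -(@ltr_nat R) -ltrN2; lra.
have [C1 [C2 [C10 C20 massP]]] :=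
  @mass_eball_power R d m0 M0 E0 H0 gamma s cPhi b d_ge3 m0_gt0 M0_gt0 E0_gt0 g0 s01
    cPhi_gt0 b_angular r r0.
pose beta := - (gamma + 2).
have beta0 : 0 < beta by rewrite /beta; lra.
have beta2s : beta < 2 * s by rewrite /beta; have := gamma_2s; lra.
have gbeta : gamma + 2 = - beta by rewrite /beta opprK.
pose G := 2 `^ beta * (2 * r) `^ (2 * s - beta) / (1 - 2 `^ (beta - 2 * s)).
have x1 : 2 `^ (beta - 2 * s) < 1.
  rewrite -opprB powRN invf_lt1 ?powR_gt0//.
  have pb : 0 < 2 * s - beta by lra.
  have := @gt0_ltr_powR R _ pb 1 2; rewrite powR1; apply; rewrite ?nnegrE//.
  by rewrite ltr1n.
have G0 : 0 < G.
  by rewrite divr_gt0 ?subr_gt0// mulr_gt0 ?powR_gt0// mulr_gt0.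
exists (G * C1 * M0), (G * C2 * M0); split.
- by apply: mulr_gt0 => //; exact: mulr_gt0.
- by apply: mulr_ge0; [apply: mulr_ge0|]; exact: ltW.
move=> f bf; have [mf f0 _ fM _ _] := bf.
have D0 := @entropy_dissipation_ge0 R d cPhi gamma b f cPhi_gt0 b0 f0.
have [Dfin|] := boolP (entropy_dissipation cPhi gamma b f \is a fin_num); last first.
  rewrite ge0_fin_numE// -leNgt leye_eq => /eqP ->.
  have GM : 0 < G * C1 * M0 by apply: mulr_gt0 => //; exact: mulr_gt0.
  by rewrite gt0_muley ?lte_fin// addye// leey.
set D := fine (entropy_dissipation cPhi gamma b f).
have DE : entropy_dissipation cPhi gamma b f = D%:E by rewrite fineK.
have D_ge0 : 0 <= D by rewrite fine_ge0.
rewrite DE -EFinM -EFinD.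
have -> : G * C1 * M0 * D + G * C2 * M0 = G * (C1 * D + C2) * M0 by ring.
have S0 : 0 <= C1 * D + C2 by rewrite addr_ge0 ?mulr_ge0// ltW.
apply: interaction_le => //; first by rewrite mulr_ge0// ltW.
move=> w wr; rewrite gbeta.
have mw e : 0 < e -> (mass f (eball w e) <= (e `^ (2 * s) * (C1 * D + C2))%:E)%E.
  by apply: massP => //; rewrite DE.
have r2 : 0 < 2 * r by rewrite mulr_gt0.
apply: le_trans (potential_le mf f0 r2 beta0 beta2s S0 mw).
rewrite [leLHS]integral_mkcond; apply: le_lower_integral => v _.
  by apply: erestrict_ge0 => u _; rewrite lee_fin mulr_ge0 ?powR_ge0.
rewrite /patch; case: ifPn => [|_]; last first.
  by rewrite lee_fin mulr_ge0// mulr_ge0 ?powR_ge0.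
rewrite inE /= => vr; rewrite indicE mem_set ?mul1r// /eball /=.
by have := ler_enormD v (- w); rewrite enormN; lra.
Qed.

End interaction_dissipation.

(** * Integrability in time *)

Theorem corollary0p4 (R : realType) (d : nat) (T gamma s cPhi : R) (b : R -> R)
    (f0 : 'rV[R]_d -> R) (f : R -> 'rV[R]_d -> R) (m0 M0 E0 H0 : R)
    (d_ge2 : (2 <= d)%N) (T_gt0 : 0 < T)
    (gamma_range : - d%:R < gamma <= 0) (s_range : 0 < s < 1)
    (gamma_2s : - 2 < gamma + 2 * s)
    (cPhi_gt0 : 0 < cPhi) (b_angular : angular_kernel d s b)
    (m0_gt0 : 0 < m0) (M0_gt0 : 0 < M0) (E0_gt0 : 0 < E0)
    (f0_measurable : measurable_fun setT f0) (f0_ge0 : forall v, 0 <= f0 v)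
    (f0_mass : (m0%:E <= \int[lebesgue_rV d]_v (f0 v)%:E <= M0%:E)%E)
    (f0_energy : (\int[lebesgue_rV d]_v (f0 v * enorm v ^+ 2)%:E <= E0%:E)%E)
    (f0_entropy : (entropy f0 <= H0%:E)%E)
    (f_sol : H_solution cPhi gamma b f0 f) :
  forall r : R, 0 < r ->
    (\int[lebesgue_measure]_(t in `[0%R, T])
       \int[lebesgue_rV d]_(w in [set w : 'rV[R]_d | (enorm w < r)%R])
       \int[lebesgue_rV d]_(v in [set v : 'rV[R]_d | (enorm v < r)%R])
         (f t v * f t w * enorm (v - w) `^ (gamma + 2))%:E < +oo)%E.
Proof.
move=> r r0; have [_ b0 _] := b_angular.
have /andP[mass_ge mass_le] := f0_mass.
have f_ge0 t : 0 <= t -> forall v, 0 <= f t v by move=> t0 v; exact: (Hsol_ge0 f_sol).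
have D_ge0 t : 0 <= t -> (0 <= entropy_dissipation cPhi gamma b (f t))%E.
  by move=> t0; apply: entropy_dissipation_ge0 => //; exact: f_ge0.
have mf t : 0 <= t -> measurable_fun setT (f t).
  move=> t0.
  apply: (@measurable_comp _ _ _ _ _ _
    ([set t | 0 <= t] `*` setT : set (measurableTypeR R * 'rV[R]_d))
    (fun p => f p.1 p.2) setT (fun v => (t, v))).
  - apply: measurableX => //.
    rewrite (_ : [set _ | _] = `[0, +oo[%classic)//.
    by apply/seteqP; split => x /=; rewrite in_itv/= andbT.
  - by move=> _ [v _ <-] /=.
  - exact: (Hsol_measurable f_sol).
  - exact: pair1_measurable.
have intD_ge0 t : (0 <= \int[lebesgue_measure]_(tau in `[0%R, t])
    entropy_dissipation cPhi gamma b (f tau))%E.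
  by apply: integral_ge0 => tau /=; rewrite in_itv/= => /andP[tau0 _]; exact: D_ge0.
have bf t : 0 <= t -> bounded_density m0 M0 E0 H0 (f t).
  move=> t0; split.
  - exact: mf.
  - exact: f_ge0.
  - by rewrite (Hsol_mass f_sol).
  - by rewrite (Hsol_mass f_sol).
  - by rewrite (Hsol_energy f_sol).
  - apply: le_trans f0_entropy; apply: le_trans (Hsol_entropy f_sol t0).
    by rewrite leeDl.
have [c [C [c0 C0 HI]]] := @interaction_le_dissipation R d m0 M0 E0 H0 gamma s cPhi b
  m0_gt0 M0_gt0 E0_gt0 gamma_range s_range gamma_2s cPhi_gt0 b_angular r r0.
have T0 := ltW T_gt0.
have tin t : `[0, T]%classic t -> 0 <= t by rewrite /= in_itv/= => /andP[].
apply: (le_lt_trans (lower_integral_affine_le lebesgue_measure _ c0 C0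
  (f := fun t => entropy_dissipation cPhi gamma b (f t)) _ _ _)).
- exact: measurable_itv.
- by move=> t /tin t0; exact: D_ge0.
- move=> t /tin t0; apply: integral_ge0 => w _; apply: integral_ge0 => v _.
  by rewrite lee_fin mulr_ge0 ?powR_ge0// mulr_ge0 ?f_ge0.
- by move=> t /tin t0; exact: HI (bf t t0).
have Dfin : (\int[lebesgue_measure]_(tau in `[0%R, T])
    entropy_dissipation cPhi gamma b (f tau) < +oo)%E.
  have := Hsol_entropy f_sol T0 => /le_trans/(_ f0_entropy).
  have [mfT fT0 _ _ fE _] := bf T T0; have := entropy_ge mfT fT0 fE.
  set N := negative_entropy_bound E0; set X := integral _ _ _ => He HX.
  have : ((- N)%:E + X <= H0%:E)%E by apply: le_trans HX; exact: leeD2r.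
  by rewrite -leeBrDl// -EFinB => /le_lt_trans; apply; exact: ltry.
rewrite lte_add_pinfty//; first by rewrite lte_mul_pinfty// lee_fin ltW.
rewrite /= lebesgue_measure_itv/= lte_fin T_gt0 -EFinB -EFinM; exact: ltry.
Qed.
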